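(* Let $d\ge 2$ and $r\ge1$ be integers, let $\vec n=(n_1,\dots,n_d)$ with $n_i\ge r^2$ for all $i$, and let $m=r^{d-1}$. There exists $\Omega_1\subseteq\mathcal{W}^d_{r,\vec n}$ with $\mu(\Omega_1)=0$ such that for any $\vec{\mathbf{w}}\in\mathcal{W}^d_{r,\vec n}\setminus\Omega_1$ and $\mathbf{T}=\tau(\vec{\mathbf{w}})$, there exists $\Omega_2\subseteq\mathcal{U}^d_{m,\vec n}$ with $\mu(\Omega_2)=0$ such that, for every initial point $\vec{\mathbf{u}}_0\in\mathcal{U}^d_{m,\vec n}$ with $\vec{\mathbf{u}}_0\notin\Omega_2$, the alternating least square (ALS) algorithm with target tensor $\mathbf{T}$ and initial point $\vec{\mathbf{u}}_0$ converges to the global minimum in $d$ microsteps, i.e., the point $\vec{\mathbf{u}}_1$ obtained after the first $d$ microsteps (one loop) is a global minimizer of $\vec{\mathbf{u}}\mapsto\frac12\|\mathbf{T}-\tau(\vec{\mathbf{u}})\|_F^2$ over $\mathcal{U}^d_{m,\vec n}$.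
   Context: Notation. For a positive integer $s$, $\mathcal{U}^d_{s,\vec n}=\prod_{i=1}^d\mathbb{R}^{s\times n_i\times s}$. For $\vec{\mathbf{u}}=(\mathbf{u}^{[1]},\dots,\mathbf{u}^{[d]})\in\mathcal{U}^d_{s,\vec n}$, $\mathbf{u}^{[i]}_{k,k'}=\mathbf{u}^{[i]}(k,:,k')\in\mathbb{R}^{n_i}$, and $$\tau(\vec{\mathbf{u}})=\sum_{k_1,\dots,k_d=1}^s\mathbf{u}^{[1]}_{k_1,k_2}\otimes\mathbf{u}^{[2]}_{k_2,k_3}\otimes\cdots\otimes\mathbf{u}^{[d]}_{k_d,k_1}\in\mathbb{R}^{n_1\times\cdots\times n_d}.$$ $\mathcal{W}^d_{r,\vec n}$ is the linear subspace of those $\vec{\mathbf{w}}\in\mathcal{U}^d_{r,\vec n}$ with $\mathbf{w}^{[i]}(k_1,s,k_2)=0$ for all $1\le i\le d$, $1\le k_1,k_2\le r$ and $s\ge r^2+1$. $\mu$ denotes the Lebesgue measure on the relevant Euclidean space ($\mathcal{W}^d_{r,\vec n}$ or $\mathcal{U}^d_{m,\vec n}$). $\|\cdot\|_F$ is the Frobenius norm. ALS algorithm. Given $\mathbf{T}$ and $\vec{\mathbf{u}}_0\in\mathcal{U}^d_{m,\vec n}$: for $\ell=0,1,2,\dots$, and for $i=1,2,\dots,d$ in this order, perform the microstep $$\mathbf{u}^{[i]}_{\ell+1}=\operatorname*{arg\,min}_{\mathbf{v}\in\mathbb{R}^{m\times n_i\times m}}\tfrac12\big\|\mathbf{T}-\tau\big(\mathbf{u}^{[1]}_{\ell+1},\dots,\mathbf{u}^{[i-1]}_{\ell+1},\mathbf{v},\mathbf{u}^{[i+1]}_{\ell},\dots,\mathbf{u}^{[d]}_{\ell}\big)\big\|_F^2,$$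 where $\vec{\mathbf{u}}_\ell=(\mathbf{u}^{[1]}_\ell,\dots,\mathbf{u}^{[d]}_\ell)$. *)

(* Defs.v *)
From mathcomp Require Import all_boot all_order all_algebra.
From mathcomp Require Import all_classical all_reals all_analysis.

Set Implicit Arguments.
Unset Strict Implicit.
Unset Printing Implicit Defensive.

Import Order.TTheory GRing.Theory Num.Theory.

Local Open Scope classical_set_scope.
Local Open Scope ring_scope.

(** * Lebesgue measure on [R^I], [I] a finite type *)

Definition box (R : realType) (I : finType) (a b : I -> R) : set (I -> R) :=
  [set x | forall i, a i <= x i <= b i].

(* The infimum of the total volumes of countable covers by closed boxes. The
   condition [a k i <= b k i] makes each product the actual volume of its box. *)
Definition lebesgue_outer (R : realType) (I : finType) (A : set (I -> R))
    : \bar R :=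
  ereal_inf [set S | exists a b : nat -> I -> R,
    [/\ forall k i, a k i <= b k i,
        A `<=` \bigcup_k box (a k) (b k) &
        S = (\sum_(0 <= k <oo) (\prod_i (b k i - a k i))%:E)%E]].

(* A set is Lebesgue measurable of measure 0 iff its outer measure is 0, so no
   separate measurability condition is needed. *)
Definition lebesgue_null (R : realType) (I : finType) (A : set (I -> R)) :=
  lebesgue_outer A = 0%E.

(** * Tensor networks on a cycle

    All indices start at 0, and [ordS] is the cyclic successor on ['I_d]. *)

Definition core (R : realType) (s q : nat) := 'I_s -> 'I_q -> 'I_s -> R.

Definition U (R : realType) (d s : nat) (n : 'I_d -> nat) :=
  forall i : 'I_d, core R s (n i).

Definition tensor (R : realType) (d : nat) (n : 'I_d -> nat) :=
  {dffun forall i : 'I_d, 'I_(n i)} -> R.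

Definition outer_product (R : realType) (d : nat) (n : 'I_d -> nat)
    (x : forall i : 'I_d, 'I_(n i) -> R) : tensor R n :=
  fun j => \prod_i x i (j i).

Definition tau (R : realType) (d s : nat) (n : 'I_d -> nat) (u : U R s n)
    : tensor R n :=
  fun j => \sum_(k : {ffun 'I_d -> 'I_s})
    outer_product (fun i q => u i (k i) q (k (ordS i))) j.

Definition W (R : realType) (d r : nat) (n : 'I_d -> nat) : set (U R r n) :=
  [set w | forall (i : 'I_d) (k1 : 'I_r) (q : 'I_(n i)) (k2 : 'I_r),
    (r ^ 2 <= q)%N -> w i k1 q k2 = 0].
Arguments W R {d} r n.

Definition coord_index (d s : nat) (n : 'I_d -> nat) : finType :=
  {i : 'I_d & 'I_s * 'I_(n i) * 'I_s}%type.

Definition coord (R : realType) (d s : nat) (n : 'I_d -> nat) (u : U R s n)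
    (x : coord_index s n) : R :=
  u (tag x) (tagged x).1.1 (tagged x).1.2 (tagged x).2.

Definition null_U (R : realType) (d s : nat) (n : 'I_d -> nat)
    (A : set (U R s n)) :=
  lebesgue_null [set coord u | u in A].

(* The coordinates that are not forced to vanish on [W]; on [W] they are an
   isometry onto a Euclidean space. *)
Definition W_index (d r : nat) (n : 'I_d -> nat) : finType :=
  {x : coord_index r n | ((tagged x).1.2 < r ^ 2)%N}.

Definition W_coord (R : realType) (d r : nat) (n : 'I_d -> nat) (w : U R r n)
    (x : W_index r n) : R :=
  coord w (val x).

(* Meaningful for subsets of [W] only. *)
Definition null_W (R : realType) (d r : nat) (n : 'I_d -> nat)
    (A : set (U R r n)) :=
  lebesgue_null [set W_coord w | w in A].

(** * Alternating least squares *)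

Definition frobenius (R : realType) (d : nat) (n : 'I_d -> nat)
    (X : tensor R n) : R :=
  Num.sqrt (\sum_j X j ^+ 2).

Definition objective (R : realType) (d s : nat) (n : 'I_d -> nat)
    (T : tensor R n) (u : U R s n) : R :=
  2^-1 * frobenius (fun j => T j - tau u j) ^+ 2.

Definition is_minimizer (R : realType) (X : Type) (f : X -> R) (x : X) :=
  forall y, f x <= f y.

(* [eqtype.dfwith f v] is [f] with its [i]-th component replaced by [v]. *)
Definition als_microstep (R : realType) (d s : nat) (n : 'I_d -> nat)
    (T : tensor R n) (uold unew : U R s n) (i : 'I_d) :=
  is_minimizer
    (fun v : core R s (n i) => objective T
       (eqtype.dfwith (fun j : 'I_d => if (j < i)%N then unew j else uold j) v))
    (unew i).

(* [u l] is the point reached after [l] loops. A relation rather than a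
   function, as the minimizer of a microstep need not be unique. *)
Definition als_run (R : realType) (d s : nat) (n : 'I_d -> nat)
    (T : tensor R n) (u0 : U R s n) (u : nat -> U R s n) :=
  u 0%N = u0 /\ forall l i, als_microstep T (u l) (u l.+1) i.

(* Main.v *)
(* Let [E_i(u)] be the family of the [m^2] tensors obtained from the network by
   deleting core [i] and fixing the two bonds cut open.  Microstep [i] is a least
   squares problem in the span of [E_i]; when [E_i] is free its solution is
   unique, rational in the other cores, and its fibres lie in the span [V_i] of
   the fibres of [w_i], which has dimension [r^2].  So before the last microstep
   the [m^2 = (r^2)^(d-1)] members of [E_d] lie in the tensor product of
   [V_1, ..., V_(d-1)], and if they are free they span it.  That space contains
   what the last core has to match, so the last residual is 0.

   Clearing denominators with adjugates rescales each core by a nonzero factor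
   only, so all the [E_i] are free as soon as one polynomial in the starting
   point does not vanish, and the zero set of a nonzero polynomial is null.  The
   polynomial is nonzero at a network [u*] with [tau u* = tau w] all of whose
   [E_i] are free, hence a fixed point of the algorithm: bond [b] of [u*]
   carries the bond indices of [w] of all bonds but one, core [s] being
   [w_s] tensored with identities, so that [E_i] consists of all the products of one
   fibre of each [w_s] with [s <> i]. *)
Require Import Defs.
From mathcomp Require Import all_boot all_order all_algebra.
From mathcomp Require Import all_classical all_reals all_analysis.
From mathcomp Require Import ring lra zify.

Set Implicit Arguments.
Unset Strict Implicit.
Unset Printing Implicit Defensive.

Import Order.TTheory GRing.Theory Num.Theory.
Import numFieldNormedType.Exports.

Local Open Scope classical_set_scope.
Local Open Scope ring_scope.

(** * Sets of measure zero *)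

Section NullSets.
Variables (R : realType) (I : finType).
Implicit Types (A B : set (I -> R)) (a b : I -> R).

Definition box_vol a b : R := \prod_i (b i - a i).

Definition small_cover A (e : R) :=
  exists a b : nat -> I -> R,
    [/\ forall k i, a k i <= b k i, A `<=` \bigcup_k box (a k) (b k) &
        (\sum_(0 <= k <oo) (box_vol (a k) (b k))%:E <= e%:E)%E].

Lemma box_vol_ge0 a b : (forall i, a i <= b i) -> 0 <= box_vol a b.
Proof. by move=> ab; apply: prodr_ge0 => i _; rewrite subr_ge0. Qed.

Lemma null_small_coverP A :
  lebesgue_null A <-> forall e, 0 < e -> small_cover A e.
Proof.
split=> [A0 e e0|Ae].
  have fin : lebesgue_outer A \is a fin_num by rewrite A0.
  have [S [a [b [ab Aab ->]]] Se] := lb_ereal_inf_adherent e0 fin.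
  exists a, b; split=> //; apply: ltW; apply: lt_le_trans Se _.
  by rewrite -/(lebesgue_outer A) A0 add0e.
apply/eqP; rewrite eq_le; apply/andP; split.
  apply/lee_addgt0Pr => e e0; have [a [b [ab Aab abe]]] := Ae e e0.
  rewrite add0e; apply: le_trans abe; apply: ereal_inf_lbound.
  by exists a, b.
apply: le_ereal_inf_tmp => S [a [b [ab _ ->]]].
by apply: nneseries_ge0 => k _ _; rewrite lee_fin; exact: box_vol_ge0.
Qed.

Lemma null_subset A B : A `<=` B -> lebesgue_null B -> lebesgue_null A.
Proof.
move=> AB /null_small_coverP Be; apply/null_small_coverP => e /Be.
by move=> [a [b [ab Bab abe]]]; exists a, b; split=> //; apply: subset_trans Bab.
Qed.

(** Cover [A k] within [e / 2 ^ k.+1] and enumerate the double family of boxes along a bijection of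
    [nat] with [nat * nat]. *)
Lemma null_bigcup (A : nat -> set (I -> R)) :
  (forall k, lebesgue_null (A k)) -> lebesgue_null (\bigcup_k A k).
Proof.
move=> A0; apply/null_small_coverP => e e0.
have /choice[ab abP] : forall k, exists ab : nat -> (I -> R) * (I -> R),
    [/\ forall l i, (ab l).1 i <= (ab l).2 i,
        A k `<=` \bigcup_l box (ab l).1 (ab l).2 &
        (\sum_(0 <= l <oo) (box_vol (ab l).1 (ab l).2)%:E
           <= (e / (2 ^ k.+1)%:R)%:E)%E].
  move=> k; have e2 : 0 < e / (2 ^ k.+1)%:R.
    by rewrite divr_gt0// ltr0n expn_gt0.
  have /null_small_coverP/(_ _ e2)[a [b [ab Aab abe]]] := A0 k.
  by exists (fun l => (a l, b l)).
have /card_esym/ppcard_eqP[f] := card_nat2.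
pose g k l := (box_vol (ab k l).1 (ab k l).2)%:E.
have g0 k l : (0 <= g k l)%E.
  by rewrite lee_fin; apply: box_vol_ge0 => i; have [+ _ _] := abP k.
exists (fun p => (ab (f p).1 (f p).2).1), (fun p => (ab (f p).1 (f p).2).2).
split=> [p i|x [k _]|].
- by have [+ _ _] := abP (f p).1.
- have [_ + _] := abP k => /[apply] -[l _ xl].
  exists (f^-1%FUN (k, l)) => //=.
  by rewrite invK ?inE.
- rewrite (_ : (\sum_(0 <= p <oo) _)%E =
              (\sum_(0 <= p <oo) g (f p).1 (f p).2)%E) //.
  rewrite nneseries_esumT//.
  rewrite -(@reindex_esum _ _ _ setT setT f (fun q => g q.1 q.2)); last first.
    exact: 'bij_f.
  rewrite (_ : [set: nat * nat] = setT `*`` (fun=> setT)); last first.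
    by apply/seteqP; split.
  rewrite -(@esum_esum _ _ _ setT (fun=> setT) g)//.
  rewrite (eq_esum (b := fun k => (\sum_(0 <= l <oo) g k l)%E)); last first.
    by move=> k _; rewrite nneseries_esumT.
  rewrite -nneseries_esumT; last by move=> k; apply: nneseries_ge0 => *; exact: g0.
  apply: le_trans (epsilon_trick0 xpredT (ltW e0)).
  apply: lee_nneseries => [k _ _|k _]; last by have [] := abP k.
  by apply: nneseries_ge0 => *; exact: g0.
Qed.

Lemma null_bigcup_count (T : countType) (t0 : T) (A : T -> set (I -> R)) :
  (forall t, lebesgue_null (A t)) -> lebesgue_null (\bigcup_t A t).
Proof.
(* Numbers that code no element of [T] are sent to [t0]. *)
move=> A0; apply: (@null_subset _ (\bigcup_k A (odflt t0 (unpickle k)))).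
  by move=> x [t _ At]; exists (pickle t) => //; rewrite pickleK.
by apply: null_bigcup => k; exact: A0.
Qed.

(* In dimension 0 every box has volume 1, hence the point [i0]. *)
Lemma null_fin_cover (i0 : I) A :
  (forall e, 0 < e -> exists (T : finType) (a b : T -> I -> R),
    [/\ forall t i, a t i <= b t i, A `<=` \bigcup_t box (a t) (b t) &
        \sum_t box_vol (a t) (b t) <= e]) ->
  lebesgue_null A.
Proof.
move=> Ae; apply/null_small_coverP => e /Ae[T [a [b [ab Aab abe]]]].
pose a' k := if insub k is Some j then a (@enum_val _ T j) else fun=> 0.
pose b' k := if insub k is Some j then b (@enum_val _ T j) else fun=> 0.
exists a', b'; split.
- by move=> k i; rewrite /a' /b'; case: insubP.
- move=> x /Aab[t _ xt]; exists (enum_rank t) => //.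
  by rewrite /a' /b' valK/= enum_rankK.
- rewrite (nneseries_split 0 #|T|); last first.
    move=> k _; rewrite lee_fin; apply: box_vol_ge0 => i.
    by rewrite /a' /b'; case: insubP.
  rewrite eseries0 ?adde0; last first.
    move=> k; rewrite add0n => Tk _; rewrite /a' /b' insubF ?ltnNge ?Tk//.
    by rewrite /box_vol (bigD1 i0)//= subrr mul0r.
  rewrite add0n sumEFin lee_fin big_mkord.
  rewrite (eq_bigr (fun j => box_vol (a (enum_val j)) (b (enum_val j)))).
    by rewrite -(big_enum_val (fun t => box_vol (a t) (b t))).
  by move=> j _; rewrite /a' /b' valK.
Qed.

Lemma null_set0 (i0 : I) : lebesgue_null (@set0 (I -> R)).
Proof.
apply: (null_fin_cover i0) => e e0; exists void, (fun=> fun=> 0), (fun=> fun=> 0).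
by split=> //; rewrite big1 ?ltW// => -[].
Qed.

End NullSets.

(** * Lipschitz graphs are null *)

Section LipschitzPatch.
Variable R : realType.

Lemma grid_cell (n : nat) (t eta : R) :
  0 <= t <= n.+1%:R * eta -> exists k : 'I_n.+1, k%:R * eta <= t <= k.+1%:R * eta.
Proof.
move=> /andP[t0]; elim: n => [|n IHn] tn.
  by exists ord0; rewrite /= mul0r t0.
have [/IHn[k kt]|nt] := leP t (n.+1%:R * eta).
  by exists (widen_ord (leqnSn _) k).
by exists ord_max; rewrite /= (ltW nt).
Qed.

(** On [S] coordinate [i] is a Lipschitz function of the others. Over a cell of side [dl / K] in
    those it stays within [h], of order [1 / K], of a chosen value, so the boxes over all cells have
    total volume of order [1 / K]. *)
Lemma null_lipschitz_patch (I : finType) (i : I) (S : set (I -> R))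
    (c : I -> R) (dl L : R) :
  0 < dl -> 0 <= L ->
  (forall z, S z -> forall j, c j <= z j <= c j + dl) ->
  (forall z z', S z -> S z' ->
     `|z' i - z i| <= L * \sum_(j | j != i) `|z' j - z j|) ->
  lebesgue_null S.
Proof.
move=> dl0 L0 Sc SL; apply: (null_fin_cover i) => e e0.
pose D : R := \prod_(j : I | j != i) dl.
pose N : R := \sum_(j : I | j != i) 1.
have D0 : 0 <= D by apply: prodr_ge0 => *; exact: ltW.
have N0 : 0 <= N by apply: sumr_ge0 => *.
(* The covering built below has total volume [C / K]. *)
pose C := 2 * (L * (N * dl)) * D.
have C0 : 0 <= C by rewrite !mulr_ge0// ltW.
pose K := (Num.truncn (C / e)).+1.
have K0 : 0 < K%:R :> R by rewrite ltr0n.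
have CK : C / K%:R <= e.
  rewrite ler_pdivrMr// mulrC -ler_pdivrMr//; apply: ltW.
  exact: truncnS_gt.
pose eta := dl / K%:R.
have eta0 : 0 < eta by rewrite divr_gt0.
have Keta : K%:R * eta = dl by rewrite mulrC divfK// gt_eqF.
pose h := L * (N * eta).
have h0 : 0 <= h by rewrite !mulr_ge0// ltW.
pose cell (p : {ffun I -> 'I_K}) : set (I -> R) := [set z | S z /\ forall j, j != i ->
  c j + (p j)%:R * eta <= z j <= c j + (p j).+1%:R * eta].
pose s p := xget c (cell p).
(* Only the copies with [p i = 0] get thickness [h]; the others are flat. Letting [p] range over all
   functions makes the sum of products factor. *)
pose hh (k : 'I_K) := if k == ord0 then h else 0.
have hh0 k : 0 <= hh k by rewrite /hh; case: ifP.
exists {ffun I -> 'I_K},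
  (fun p j => if j == i then s p i - hh (p i) else c j + (p j)%:R * eta),
  (fun p j => if j == i then s p i + hh (p i) else c j + (p j).+1%:R * eta).
split.
- move=> p j; case: ifP => _; first by rewrite lerD2l ge0_cp.
  by rewrite lerD2l ler_pM2r// ler_nat.
- move=> z Sz.
  have /choice[p pz] : forall j, exists k : 'I_K, k%:R * eta <= z j - c j <= k.+1%:R * eta.
    move=> j; apply: grid_cell; rewrite -/K Keta.
    by have /andP[] := Sc z Sz j; lra.
  pose q := [ffun j => if j == i then ord0 else p j].
  have qz : cell q z.
    split=> // j ji; rewrite ffunE (negbTE ji).
    by have /andP[] := pz j; lra.
  have [Ss cs] : cell q (s q) by exact: (xgetPex c (ex_intro _ z qz)).
  exists q => //= j; case: eqP => [->|/eqP ji]; last exact: qz.2.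
  rewrite /hh ffunE eqxx -ler_distl.
  apply: (le_trans (SL _ _ Ss Sz)); rewrite ler_wpM2l// mulr_suml.
  apply: ler_sum => k ki; rewrite mul1r ler_norml.
  have /andP[] := cs k ki; have /andP[] := qz.2 k ki.
  by rewrite -natr1; lra.
- pose W j (k : 'I_K) := if j == i then 2 * hh k else eta.
  rewrite (eq_bigr (fun p : {ffun I -> 'I_K} => \prod_j W j (p j))); last first.
    move=> p _; apply: eq_bigr => j _; rewrite /W; case: eqP => [->|_].
      by lra.
    by rewrite -natr1; lra.
  rewrite -bigA_distr_bigA (bigD1 i)//= {1}/W eqxx.
  rewrite [X in _ * X](eq_bigr (fun=> dl)); last first.
    move=> j ji; rewrite /W (negbTE ji) sumr_const card_ord -mulr_natl.
    exact: Keta.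
  rewrite -/D big_ord_recl/= big1 => [|k _]; last by rewrite /hh/= mulr0.
  rewrite addr0 /hh eqxx; apply: le_trans CK; rewrite /C /h /eta.
  by rewrite le_eqVlt; apply/orP; left; apply/eqP; field; rewrite gt_eqF.
Qed.

End LipschitzPatch.

(** * Zero sets of polynomial functions *)

Section PolynomialFunctions.
Variables (R : realType) (I : finType).
Implicit Types (f h : (I -> R) -> R) (g : I -> (I -> R) * (I -> R) -> R).

(** The neighbourhoods of the diagonal point [(z, z)] for the sup distance. *)
Definition nearp (z : I -> R) : set_system ((I -> R) * (I -> R)) :=
  [set P | exists2 e : R, 0 < e & forall x y,
    (forall j, `|x j - z j| < e) -> (forall j, `|y j - z j| < e) -> P (x, y)].

Global Instance nearp_filter z : Filter (nearp z).
Proof.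
split=> [|P Q [e e0 Pe] [d d0 Qd]|P Q PQ [e e0 Pe]].
- by exists 1.
- exists (Num.min e d) => [|x y xz yz]; first by rewrite lt_min e0.
  by split; [apply: Pe|apply: Qd] => j;
    [have := xz j|have := yz j|have := xz j|have := yz j];
    rewrite lt_min => /andP[].
- by exists e => // x y xz yz; apply: PQ; exact: Pe.
Qed.

Definition diag_continuous f := forall z,
  (f \o fst) @ nearp z --> f z /\ (f \o snd) @ nearp z --> f z.

(* Hadamard's lemma as a definition: [g j] is continuous on the diagonal, where
   it is the [j]-th partial derivative of [f]. *)
Definition has_quotient f g :=
  (forall x y, f y - f x = \sum_j (y j - x j) * g j (x, y)) /\
  (forall j z, g j @ nearp z --> g j (z, z)).

(** Polynomial of degree at most [m], phrased by differentiation: each partial derivative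
    [g j (x, x)] drops the degree by one. The induction on null zero sets runs along this form. *)
Fixpoint pdeg (m : nat) f : Prop :=
  if m is m'.+1 then
    diag_continuous f /\ exists2 g, has_quotient f g &
      forall j, pdeg m' (fun x => g j (x, x))
  else exists c, f = fun=> c.

Lemma diag_continuous_cst (c : R) : diag_continuous (fun=> c).
Proof. by move=> z; split; exact: cvg_cst. Qed.

Lemma pdeg_cst m (c : R) : pdeg m (fun=> c).
Proof.
elim: m c => [|m IHm] c /=; first by exists c.
split; first exact: diag_continuous_cst.
exists (fun=> fun=> 0) => [|j]; last exact: IHm.
split=> [x y|j z] /=; last exact: cvg_cst.
by rewrite subrr big1// => j _; rewrite mulr0.
Qed.

Lemma pdeg_leq m p f : (m <= p)%N -> pdeg m f -> pdeg p f.
Proof.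
elim: m p f => [p f _ [c ->]|m IHm [|p] f //]; first exact: pdeg_cst.
move=> mp [cf [g fg gm]]; split=> //; exists g => // j; exact: (IHm p _ mp (gm j)).
Qed.

Lemma pdeg_proj j : pdeg 1 (fun x => x j).
Proof.
split.
  move=> z; split; apply/cvgrPdist_lt => e e0; exists e => //= x y xz yz.
    by rewrite distrC.
  by rewrite distrC.
exists (fun k => fun=> (k == j)%:R).
  split=> [x y|k z] /=; last exact: cvg_cst.
  rewrite (bigD1 j)//= eqxx mulr1 big1 ?addr0// => k /negbTE ->.
  by rewrite mulr0.
by move=> k; exists (k == j)%:R.
Qed.

Lemma pdegD m f h : pdeg m f -> pdeg m h -> pdeg m (fun x => f x + h x).
Proof.
elim: m f h => [|m IHm] f h; first by move=> [c ->] [d ->]; exists (c + d).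
move=> [cf [g [fg gc] gm]] [ch [k [hk kc] km]]; split.
  move=> z; have [? ?] := cf z; have [? ?] := ch z.
  by split; apply: cvgD.
exists (fun j p => g j p + k j p) => [|j]; last exact: (IHm _ _ (gm j) (km j)).
split=> [x y|j z]; last by apply: cvgD.
rewrite opprD addrACA fg hk -big_split/=.
by apply: eq_bigr => j _; rewrite mulrDr.
Qed.

Lemma pdegZ m (c : R) f : pdeg m f -> pdeg m (fun x => c * f x).
Proof.
elim: m f => [|m IHm] f; first by move=> [d ->]; exists (c * d).
move=> [cf [g [fg gc] gm]]; split.
  by move=> z; have [? ?] := cf z; split; (apply: cvgM; first exact: cvg_cst).
exists (fun j p => c * g j p) => [|j]; last exact: (IHm _ (gm j)).
split=> [x y|j z]; last by by apply: cvgM; [exact: cvg_cst|exact: gc].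
rewrite -mulrBr fg mulr_sumr.
by apply: eq_bigr => j _; rewrite mulrCA.
Qed.

Lemma pdegM m p f h : pdeg m f -> pdeg p h -> pdeg (m + p) (fun x => f x * h x).
Proof.
move eN : (m + p)%N => N; elim: N m p f h eN => [|N IHN] [|m] [|p] f h //= eN.
- by move=> [c ->] [d ->]; exists (c * d).
- move: eN; rewrite add0n => -[<-] [c ->] hp.
  by apply: (@pdegZ p.+1).
- move: eN; rewrite addn0 => -[<-] fm [c ->].
  rewrite (_ : (fun x => f x * c) = (fun x => c * f x)); last first.
    by apply/funext => x; rewrite mulrC.
  exact: (@pdegZ m.+1).
- move=> fm hp; have [cf [g [fg gc] gm]] := fm; have [ch [k [hk kc] kp]] := hp.
  move: eN; rewrite addSn => -[eN]; split.
    move=> z; have [? ?] := cf z; have [? ?] := ch z.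
    by split; apply: cvgM.
  (* Leibniz rule, with [h] read at the second point and [f] at the first. On the diagonal each
     summand has degrees adding up to [N], as the induction requires. *)
  exists (fun j q => g j q * h q.2 + f q.1 * k j q) => [|j].
    split=> [x y|j z] /=.
      transitivity ((f y - f x) * h y + f x * (h y - h x)); first by ring.
      rewrite fg hk mulr_suml mulr_sumr -big_split/=.
      by apply: eq_bigr => j _; ring.
    have [? _] := cf z; have [_ ?] := ch z.
    by apply: cvgD; apply: cvgM.
  apply: pdegD.
    exact: (IHN m p.+1 _ _ eN (gm j) hp).
  by apply: (IHN m.+1 p _ _ _ fm (kp j)); rewrite addSn -eN addnS.
Qed.

Definition polyfun f := exists m, pdeg m f.

Lemma polyfun_cst (c : R) : polyfun (fun=> c).
Proof. by exists 0%N, c. Qed.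

Lemma polyfun_proj j : polyfun (fun x => x j).
Proof. by exists 1%N; exact: pdeg_proj. Qed.

Lemma polyfunD f h : polyfun f -> polyfun h -> polyfun (fun x => f x + h x).
Proof.
move=> [m fm] [p hp]; exists (m + p)%N; apply: pdegD.
  by apply: pdeg_leq fm; exact: leq_addr.
by apply: pdeg_leq hp; exact: leq_addl.
Qed.

Lemma polyfunM f h : polyfun f -> polyfun h -> polyfun (fun x => f x * h x).
Proof. by move=> [m fm] [p hp]; exists (m + p)%N; exact: pdegM. Qed.

Lemma polyfun_sum (T : Type) (s : seq T) (P : pred T) (F : T -> (I -> R) -> R) :
  (forall t, P t -> polyfun (F t)) -> polyfun (fun x => \sum_(t <- s | P t) F t x).
Proof.
move=> FP; elim: s => [|t s IHs].
  by rewrite (_ : (fun _ => _) = fun=> 0);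
    [exact: polyfun_cst|apply/funext => x; rewrite big_nil].
under eq_fun do rewrite big_cons.
by case Pt: (P t) => //; apply: polyfunD => //; exact: FP.
Qed.

Lemma polyfun_prod (T : Type) (s : seq T) (P : pred T) (F : T -> (I -> R) -> R) :
  (forall t, P t -> polyfun (F t)) -> polyfun (fun x => \prod_(t <- s | P t) F t x).
Proof.
move=> FP; elim: s => [|t s IHs].
  by rewrite (_ : (fun _ => _) = fun=> 1);
    [exact: polyfun_cst|apply/funext => x; rewrite big_nil].
under eq_fun do rewrite big_cons.
by case Pt: (P t) => //; apply: polyfunM => //; exact: FP.
Qed.

Lemma polyfun_det m (A : (I -> R) -> 'M[R]_m) :
  (forall i j, polyfun (fun x => A x i j)) -> polyfun (fun x => \det (A x)).
Proof.
move=> AP; apply: polyfun_sum => s _; apply: polyfunM; first exact: polyfun_cst.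
by apply: polyfun_prod => i _; exact: AP.
Qed.

Lemma polyfun_adj m (A : (I -> R) -> 'M[R]_m) :
  (forall i j, polyfun (fun x => A x i j)) ->
  forall i j, polyfun (fun x => \adj (A x) i j).
Proof.
move=> AP i j; under eq_fun do rewrite mxE.
apply: polyfunM; first exact: polyfun_cst.
apply: polyfun_det => i' j'; under eq_fun do rewrite !mxE.
exact: AP.
Qed.

(** Along the segment from [x] to [y], the difference quotient of [f] is a combination of the [g j]
    that tends to their diagonal values, here 0. So the derivative along the segment vanishes. *)
Lemma constant_of_quotient0 f g :
  has_quotient f g -> (forall j z, g j (z, z) = 0) -> forall x y, f x = f y.
Proof.
move=> [fg gc] g0 x y.
pose p (t : R) : I -> R := fun j => x j + t * (y j - x j).
have pE : forall t, is_derive t (1 : R) (f \o p) 0.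
  move=> t.
  have H : (fun e : R => e^-1 *: (f (p (e *: 1 + t)) - f (p t))) @ 0^' --> (0 : R).
    have H1 : (fun e : R => (p t, p (e + t))) @ 0^' --> nearp (p t).
      move=> P [e e0 Pe].
      pose M := 1 + \sum_j `|y j - x j|.
      have M0 : 0 < M by rewrite ltr_pwDl// sumr_ge0.
      suff : \forall s \near 0^', P (p t, p (s + t)) by [].
      near=> s; apply: (Pe (p t) (p (s + t))) => j; first by rewrite subrr normr0.
      rewrite (_ : _ - _ = s * (y j - x j)); last by rewrite /p; ring.
      rewrite normrM; apply: (@le_lt_trans _ _ (`|s| * M)).
        rewrite ler_wpM2l// /M (bigD1 j)//= addrCA lerDl.
        by rewrite addr_ge0// sumr_ge0.
      rewrite -ltr_pdivlMr//; near: s; apply: dnbhs0_lt; exact: divr_gt0.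
    have H2 : (fun q : (I -> R) * (I -> R) => \sum_j (y j - x j) * g j q) @ nearp (p t) --> (0 : R).
      rewrite [X in _ --> X](_ : 0 = \sum_j (y j - x j) * g j (p t, p t)); last first.
        by rewrite big1// => j _; rewrite g0 mulr0.
      apply: cvg_big => [|j _]; first exact: add_continuous.
      by apply: cvgM; [exact: cvg_cst|exact: gc].
    apply: cvg_trans (cvg_comp _ _ H1 H2).
    apply: near_eq_cvg; near=> e.
    have e0 : e != 0 by near: e; exact: nbhs_dnbhs_neq.
    rewrite /= fg /GRing.scale/= mulr1 mulr_sumr; apply: eq_bigr => j _.
    by rewrite /p; field.
  split; first by apply/cvg_ex; exists 0.
  by rewrite /derive; apply: cvg_lim.
have := is_derive_0_is_cst 0 1 pE; rewrite /= /p.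
have E0 : (fun j => x j + 0 * (y j - x j)) = x by apply/funext => j; ring.
have E1 : (fun j => x j + 1 * (y j - x j)) = y by apply/funext => j; ring.
by rewrite E0 E1.
Unshelve. all: by end_near. Qed.

(* Near a zero of [f] where the [i]-th partial derivative does not vanish, the
   zero set is a Lipschitz graph over the coordinates other than [i]. *)
Lemma null_regular_level f g i : has_quotient f g ->
  lebesgue_null [set z | f z = 0 /\ g i (z, z) != 0].
Proof.
move=> [fg gc].
(* Countably many pieces: [k] records a radius and bounds valid within it, [v] a cell of the grid of
   mesh [1 / (k + 2)]. The mesh is below the radius [1 / (k + 1)], so the bounds apply to any two
   points of one piece. *)
pose S (kv : nat * {ffun I -> int}) : set (I -> R) := [set z | [/\ f z = 0,
  forall x y, (forall j, `|x j - z j| < kv.1.+1%:R^-1) ->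
    (forall j, `|y j - z j| < kv.1.+1%:R^-1) ->
    kv.1.+1%:R^-1 <= `|g i (x, y)| /\ forall j, `|g j (x, y)| <= kv.1.+1%:R &
  forall j, (kv.2 j)%:~R * kv.1.+2%:R^-1 <= z j <=
            (kv.2 j)%:~R * kv.1.+2%:R^-1 + kv.1.+2%:R^-1]].
apply: (@null_subset _ _ _ (\bigcup_kv S kv)); last first.
  apply: null_bigcup_count; first exact: (0%N, [ffun=> 0]).
  move=> [k v].
  apply: (@null_lipschitz_patch _ _ i _ (fun j => (v j)%:~R * k.+2%:R^-1)
    k.+2%:R^-1 (k.+1%:R * k.+1%:R)) => //.
    by move=> z [].
  move=> z z' [/= fz gz zv] [/= fz' _ zv'].
  have zz' j : `|z' j - z j| < k.+1%:R^-1.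
    apply: (@le_lt_trans _ _ k.+2%:R^-1).
      move: (zv j) (zv' j) => /= /[swap].
      rewrite ler_norml; move: (k.+2%:R^-1) (_ * _) => h c /andP[a1 a2] /andP[b1 b2].
      by apply/andP; split; lra.
    by rewrite ltf_pV2 ?posrE// ltr_nat.
  have zz j : `|z j - z j| < k.+1%:R^-1 by rewrite subrr normr0.
  have [gi gj] := gz z z' zz zz'.
  (* Both values of [f] are 0, so the [i]-th term of the expansion balances the others; the bounds
     give the Lipschitz constant [(k + 1) ^ 2]. *)
  have := fg z z'; rewrite fz fz' subrr (bigD1 i)//= => /esym/eqP.
  rewrite addr_eq0 => /eqP H.
  have {}H : `|z' i - z i| * `|g i (z, z')| <=
      k.+1%:R * \sum_(j | j != i) `|z' j - z j|.
    rewrite -normrM H normrN; apply: le_trans (ler_norm_sum _ _ _) _.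
    rewrite mulr_sumr; apply: ler_sum => j _; rewrite normrM mulrC.
    by rewrite ler_wpM2r.
  rewrite -mulrA -ler_pdivrMl//; apply: le_trans H.
  by rewrite mulrC ler_wpM2l.
move=> z [fz gz].
have a0 : 0 < `|g i (z, z)| by rewrite normr_gt0.
have gi : \forall q \near nearp z, `|g i (z, z)| / 2 < `|g i q|.
  apply: (cvgr_gt _ (cvg_norm (gc i z))).
  by rewrite ltr_pdivrMr// mulr_natr mulr2n ltrDl.
have gj : \forall q \near nearp z, forall j, `|g j q| < `|g j (z, z)| + 1.
  apply: filter_forall => j; apply: (cvgr_lt _ (cvg_norm (gc j z))).
  by rewrite ltrDl.
have [e e0 He] := filterI gi gj.
pose B := \sum_j (`|g j (z, z)| + 1).
have B0 : 0 <= B by apply: sumr_ge0 => j _; rewrite addr_ge0.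
(* Large enough that [1 / (k + 1)] is below [e] and below half of [|g i (z, z)|], and [k + 1] is
   above [B]. *)
pose k := Num.truncn (e^-1 + (`|g i (z, z)| / 2)^-1 + B).
have kk := truncnS_gt (e^-1 + (`|g i (z, z)| / 2)^-1 + B).
rewrite -/k in kk.
have ei : 0 < e^-1 by rewrite invr_gt0.
have gi0 : 0 < (`|g i (z, z)| / 2)^-1 by rewrite invr_gt0 divr_gt0.
have ke : k.+1%:R^-1 <= e.
  by rewrite -[leRHS]invrK lef_pV2 ?posrE//; lra.
have kg : k.+1%:R^-1 <= `|g i (z, z)| / 2.
  by rewrite -[leRHS]invrK lef_pV2 ?posrE//; lra.
exists (k, [ffun j => Num.floor (z j * k.+2%:R)]) => //; split=> //=.
- move=> x y xz yz.
  have xz' j : `|x j - z j| < e by exact: lt_le_trans ke.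
  have yz' j : `|y j - z j| < e by exact: lt_le_trans ke.
  have /= [gix gjx] := He x y xz' yz'.
  split; first by rewrite ltW// (le_lt_trans kg).
  move=> j; rewrite ltW// (lt_le_trans (gjx j))//; apply: (@le_trans _ _ B).
    rewrite /B [leRHS](bigD1 j)//= lerDl; apply: sumr_ge0 => l _.
    by rewrite addr_ge0.
  by lra.
- move=> j; rewrite ffunE.
  apply/andP; split; first by rewrite ler_pdivrMr// floor_le.
  rewrite -[X in _ + X]mul1r -mulrDl ler_pdivlMr// ltW//.
  by rewrite -[X in _ + X]/(1%:~R) -intrD floorD1_gt.
Qed.

(** Induction on the degree. If some partial derivative is not identically 0, its zero set is null
    by induction, and the zeros of [f] outside it form a regular level. Otherwise [f] is a nonzero
    constant. *)
Lemma polyfun_null (i0 : I) f x0 :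
  polyfun f -> f x0 != 0 -> lebesgue_null [set x | f x = 0].
Proof.
move=> [m]; elim: m f x0 => [|m IHm] f x0.
  move=> [c ->] c0; apply: null_subset (null_set0 _ i0).
  by move=> x /= cx; rewrite cx eqxx in c0.
move=> [_ [g fg gm]] fx0.
have [[j [x1 gx1]]|ng] := pselect (exists j x, g j (x, x) != 0).
  pose A (b : bool) := if b then [set x | g j (x, x) = 0]
                       else [set z | f z = 0 /\ g j (z, z) != 0].
  apply: (@null_subset _ _ _ (\bigcup_b A b)).
    move=> z fz; have [gz|gz] := eqVneq (g j (z, z)) 0.
      by exists true.
    by exists false.
  apply: (null_bigcup_count true) => -[]; first exact: (IHm _ _ (gm j) gx1).
  exact: null_regular_level.
apply: null_subset (null_set0 _ i0) => x /= fx.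
move: fx0; rewrite (constant_of_quotient0 fg _ x0 x) ?fx ?eqxx// => j z.
by apply/eqP/negPn/negP => gz; apply: ng; exists j, z.
Qed.

End PolynomialFunctions.

(** * Gram matrices *)

Section FinMatrices.
Variables (R : realType) (A : finType).
Implicit Types (M : A -> A -> R) (x y : A -> R).

Definition fmx M : 'M[R]_#|A| := \matrix_(i, j) M (enum_val i) (enum_val j).
Definition fdet M := \det (fmx M).
Definition fadj M a b := \adj (fmx M) (enum_rank a) (enum_rank b).

Lemma sum_enum_rank (F : 'I_#|A| -> R) : \sum_a F (enum_rank a) = \sum_i F i.
Proof.
by rewrite [RHS](reindex (@enum_rank A))//; exact/onW_bij/enum_rank_bij.
Qed.

(** Cramer's rule, kept free of division. *)
Lemma fadj_solve M y c :
  \sum_a (\sum_b y b * fadj M b a) * M a c = fdet M * y c.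
Proof.
under eq_bigr do rewrite mulr_suml.
rewrite exchange_big/= -[fdet M * y c]mulrC.
rewrite (bigD1 c)//= [X in _ + X]big1 ?addr0 => [|b bc].
  transitivity (y c * (\adj (fmx M) *m fmx M) (enum_rank c) (enum_rank c)).
    rewrite mxE -sum_enum_rank mulr_sumr; apply: eq_bigr => a _.
    by rewrite [fmx M _ _]mxE !enum_rankK mulrA.
  by rewrite mul_adj_mx mxE eqxx.
transitivity (y b * (\adj (fmx M) *m fmx M) (enum_rank b) (enum_rank c)).
  rewrite mxE -sum_enum_rank mulr_sumr; apply: eq_bigr => a _.
  by rewrite [fmx M _ _]mxE !enum_rankK mulrA.
by rewrite mul_adj_mx mxE (inj_eq enum_rank_inj) (negbTE bc) mulr0.
Qed.

Lemma fdet_neq0P M : fdet M != 0 <->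
  forall x, (forall c, \sum_a x a * M a c = 0) -> forall a, x a = 0.
Proof.
have E x c : \sum_a x a * M a c =
    ((\row_i x (enum_val i)) *m fmx M) 0 (enum_rank c).
  rewrite mxE -sum_enum_rank; apply: eq_bigr => a _.
  by rewrite !mxE !enum_rankK.
split=> [M0 x xM a|H].
  have : (\row_i x (enum_val i)) *m fmx M = 0.
    apply/rowP => i; rewrite -[i]enum_valK -E xM.
    by rewrite mxE.
  move/(congr1 (mulmx^~ (invmx (fmx M)))); rewrite mulmxK ?unitmxE ?unitfE//.
  by rewrite mul0mx => /rowP/(_ (enum_rank a)); rewrite !mxE enum_rankK.
apply/negP => /det0P[v v0 vM]; move/negP: v0; apply; apply/eqP/rowP => i.
rewrite mxE -[i]enum_valK; apply: (H (fun a => v 0 (enum_rank a))) => c.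
transitivity ((v *m fmx M) 0 (enum_rank c)); last by rewrite vM mxE.
rewrite mxE -sum_enum_rank; apply: eq_bigr => a _.
by rewrite !mxE !enum_rankK.
Qed.

End FinMatrices.

Section Gram.
Variables (R : realType) (A J : finType) (P : pred J).
Implicit Types (f : A -> J -> R).

Definition gram f a b : R := \sum_(j | P j) f a j * f b j.

Definition fam_free f := forall c : A -> R,
  (forall j, P j -> \sum_a c a * f a j = 0) -> forall a, c a = 0.

(** A vector killed by the Gram matrix gives a combination of the family whose sum of squares is 0,
    hence a vanishing one over the reals. *)
Lemma gram_free f : fdet (gram f) != 0 <-> fam_free f.
Proof.
have E (c : A -> R) b : \sum_a c a * gram f a b =
    \sum_(j | P j) (\sum_a c a * f a j) * f b j.
  under eq_bigr do rewrite mulr_sumr.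
  rewrite exchange_big/=; apply: eq_bigr => j _; rewrite mulr_suml.
  by apply: eq_bigr => a _; rewrite mulrA.
split=> [/fdet_neq0P H c cf|H]; last apply/fdet_neq0P => c cG.
  by apply: H => b; rewrite E big1// => j /cf ->; rewrite mul0r.
apply: H => j Pj.
have : \sum_(j | P j) (\sum_a c a * f a j) ^+ 2 = 0.
  transitivity (\sum_b c b * \sum_a c a * gram f a b); last first.
    by rewrite big1// => b _; rewrite cG mulr0.
  under [RHS]eq_bigr do rewrite E mulr_sumr.
  rewrite exchange_big/=; apply: eq_bigr => k _.
  by rewrite expr2 mulr_sumr; apply: eq_bigr => a _; rewrite mulrCA.
move/eqP; rewrite psumr_eq0 => [/allP/(_ j)|k _]; last exact: sqr_ge0.
by rewrite mem_index_enum Pj sqrf_eq0 => /(_ isT)/eqP.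
Qed.

(** The dual family is the inverse Gram matrix applied to [f]. *)
Lemma free_dual f : fam_free f ->
  exists g : A -> J -> R, forall a b, \sum_(j | P j) g a j * f b j = (a == b)%:R.
Proof.
move=> /gram_free G0.
exists (fun a j => (fdet (gram f))^-1 * \sum_c fadj (gram f) a c * f c j) => a b.
transitivity ((fdet (gram f))^-1 *
    \sum_c (\sum_e (e == a)%:R * fadj (gram f) e c) * gram f c b).
  rewrite mulr_sumr /gram; under eq_bigr do rewrite -mulrA.
  rewrite -mulr_sumr -mulr_sumr; congr (_ * _).
  under eq_bigr do rewrite mulr_suml.
  rewrite exchange_big/=; apply: eq_bigr => c _; rewrite mulr_sumr.
  apply: eq_bigr => j _; rewrite (bigD1 a)//= eqxx mul1r big1 ?addr0 ?mulrA//.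
  by move=> e /negbTE ->; rewrite mul0r.
by rewrite fadj_solve mulrA mulVf// mul1r eq_sym.
Qed.

End Gram.

(** Numbering the columns in [P] by the rows, through [phi], makes [M] a square matrix with
    independent rows, inverted by its adjugate. *)
Lemma square_left_inverse (R : realType) (A B : finType) (P : pred B)
    (M : A -> B -> R) :
  #|P| = #|A| ->
  (forall c : A -> R, (forall b, P b -> \sum_a c a * M a b = 0) ->
     forall a, c a = 0) ->
  exists N : B -> A -> R, forall b b', P b -> P b' ->
    \sum_a N b a * M a b' = (b == b')%:R.
Proof.
move=> eqAB Mfree.
pose phi (a : A) : B := enum_val (cast_ord (esym eqAB) (enum_rank a)).
have phiP a : P (phi a) by exact: enum_valP.
have phi_inj : injective phi.
  by move=> a a' /enum_val_inj /cast_ord_inj /enum_rank_inj.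
have phi_surj b : P b -> exists a, phi a = b.
  move=> Pb; exists (enum_val (cast_ord eqAB (enum_rank_in Pb b))).
  by rewrite /phi enum_valK cast_ordK enum_rankK_in.
pose M' a a' := M a (phi a').
have M0 : fdet M' != 0.
  apply/fdet_neq0P => x xM; apply: Mfree => b /phi_surj[a <-]; exact: xM.
exists (fun b a => (fdet M')^-1 * \sum_e (phi e == b)%:R * fadj M' e a).
move=> b b' /phi_surj[e <-] /phi_surj[e' <-].
under eq_bigr do rewrite -mulrA.
rewrite -mulr_sumr (fadj_solve M' (fun k => (phi k == phi e)%:R)).
by rewrite mulrA mulVf// mul1r eq_sym.
Qed.

(** * Environments and normal equations *)

Section Environment.
Variables (R : realType) (d : nat) (n : 'I_d -> nat).
Local Notation index := {dffun forall i : 'I_d, 'I_(n i)}.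

(** Member [a] of the family [E_i]. It is a function of the full multi-index, constant in entry [i];
    a slice with [j i] fixed meets each remaining multi-index once. *)
Definition env (s : nat) (u : U R s n) (i : 'I_d) (a : 'I_s * 'I_s) (j : index) : R :=
  \sum_(k : {ffun 'I_d -> 'I_s} | (k i, k (ordS i)) == a)
    \prod_(l | l != i) u l (k l) (j l) (k (ordS l)).

Lemma tau_env s (u : U R s n) i j :
  tau u j = \sum_a u i a.1 (j i) a.2 * env u i a j.
Proof.
rewrite /tau /outer_product.
rewrite (partition_big (fun k : {ffun 'I_d -> 'I_s} => (k i, k (ordS i))) xpredT)//=.
apply: eq_bigr => a _; rewrite mulr_sumr; apply: eq_bigr => k /eqP <-.
by rewrite (bigD1 i).
Qed.

Lemma env_scale s (u v : U R s n) i (c : 'I_d -> R) :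
  (forall l, l != i -> forall a q b, u l a q b = c l * v l a q b) ->
  forall a j, env u i a j = (\prod_(l | l != i) c l) * env v i a j.
Proof.
move=> uv a j; rewrite mulr_sumr; apply: eq_bigr => k _.
by rewrite -big_split/=; apply: eq_bigr => l /uv ->.
Qed.

Lemma env_ext s (u v : U R s n) i :
  (forall l, l != i -> u l = v l) -> env u i = env v i.
Proof.
move=> uv; apply/funext => a; apply/funext => j; apply: eq_bigr => k _.
by apply: eq_bigr => l /uv ->.
Qed.

Lemma env_index s (u : U R s n) i a (j j' : index) :
  (forall l, l != i -> j l = j' l) -> env u i a j = env u i a j'.
Proof.
move=> jj'; apply: eq_bigr => k _.
by apply: eq_bigr => l /jj' ->.
Qed.

Lemma tau_dfwith s (u : U R s n) i (v : core R s (n i)) j :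
  tau (eqtype.dfwith u v) j = \sum_a v a.1 (j i) a.2 * env u i a j.
Proof.
rewrite (tau_env _ i) eqtype.dfwith_in.
rewrite (@env_ext s _ u)// => l li.
by rewrite eqtype.dfwith_out// eq_sym.
Qed.

Definition index_set (i : 'I_d) (q : 'I_(n i)) (j : index) : index :=
  finfun (eqtype.dfwith (fun l => j l) q).

Lemma index_set_in i (q : 'I_(n i)) j : index_set q j i = q.
Proof. by rewrite ffunE eqtype.dfwith_in. Qed.

Lemma index_set_out i (q : 'I_(n i)) j l : l != i -> index_set q j l = j l.
Proof. by move=> li; rewrite ffunE eqtype.dfwith_out// eq_sym. Qed.

(** Overwriting entry [i] is a bijection between slices; this moves every computation to one
    reference slice. *)
Lemma slice_sum i (F : index -> R) (q q' : 'I_(n i)) :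
  (forall j j' : index, (forall l, l != i -> j l = j' l) -> F j = F j') ->
  \sum_(j : index | j i == q) F j = \sum_(j : index | j i == q') F j.
Proof.
move=> FE.
have setK (p p' : 'I_(n i)) (j : index) : j i = p -> index_set p (index_set p' j) = j.
  move=> jp; apply/ffunP => l; have [->|li] := eqVneq l i.
    by rewrite index_set_in.
  by rewrite !index_set_out.
rewrite (reindex_onto (index_set q) (index_set q')); last first.
  by move=> j /eqP jq; exact: (setK _ q' _ jq).
apply: eq_big => [j|j _]; last by apply: FE => l li; rewrite index_set_out.
rewrite index_set_in eqxx/=; apply/eqP/eqP => [<-|/setK//].
by rewrite index_set_in.
Qed.

Lemma sum_prod_index (F : forall l, 'I_(n l) -> R) :
  \sum_(j : index) \prod_l F l (j l) = \prod_l \sum_q F l q.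
Proof.
pose P l : {ffun 'I_(n l) -> R} := [ffun q => F l q].
rewrite (reindex (@dffun_of_fprod _ (fun l => 'I_(n l)))); last first.
  exact/onW_bij/dffun_of_fprod_bij.
under eq_bigr => t _ do under eq_bigr => l _ do rewrite ffunE -[F l _](ffunE (F l)).
rewrite (@big_fprod R 0 1 *%R +%R _ _ P) -(bigA_distr_big_dep _ (fun l t => untag 0 (P l) t)).
apply: eq_bigr => l _; transitivity (\sum_q P l q).
  by rewrite (big_tag (fun l => P l) l).
by apply: eq_bigr => q _; rewrite ffunE.
Qed.

Lemma sum_prod_slice i (q0 : 'I_(n i)) (F : forall l, 'I_(n l) -> R) :
  \sum_(j : index | j i == q0) \prod_(l | l != i) F l (j l) =
  \prod_(l | l != i) \sum_q F l q.
Proof.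
(* With the indicator of [q0] as factor at site [i], the slice sum becomes a full sum of
   products. *)
pose G : forall l, 'I_(n l) -> R :=
  eqtype.dfwith F (fun q : 'I_(n i) => (q == q0)%:R).
have Gi q : G i q = (q == q0)%:R by rewrite /G eqtype.dfwith_in.
have Gl l : l != i -> G l = F l.
  by move=> li; rewrite /G eqtype.dfwith_out// eq_sym.
transitivity (\prod_l \sum_q G l q).
  rewrite -sum_prod_index big_mkcond; apply: eq_bigr => j _.
  rewrite [RHS](bigD1 i)//= Gi; case: eqP => _; last by rewrite mul0r.
  by rewrite mul1r; apply: eq_bigr => l /Gl ->.
rewrite (bigD1 i)//= (bigD1 q0)//= Gi eqxx [X in 1 + X]big1 => [|q /negbTE qq0].
  by rewrite addr0 mul1r; apply: eq_bigr => l /Gl ->.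
by rewrite Gi qq0.
Qed.

End Environment.

Section NormalEquations.
Variables (R : realType) (d : nat) (n : 'I_d -> nat).
Local Notation index := {dffun forall i : 'I_d, 'I_(n i)}.

Lemma objectiveE s (T : tensor R n) (u : U R s n) :
  objective T u = 2^-1 * \sum_j (T j - tau u j) ^+ 2.
Proof.
rewrite /objective /frobenius sqr_sqrtr//.
by apply: sumr_ge0 => j _; exact: sqr_ge0.
Qed.

Lemma orthogonal_of_min (J : finType) (x e : J -> R) :
  (forall t, \sum_j x j ^+ 2 <= \sum_j (x j - t * e j) ^+ 2) ->
  \sum_j x j * e j = 0.
Proof.
move=> H; pose A := \sum_j x j * e j; pose B := \sum_j e j ^+ 2.
have B0 : 0 <= B by apply: sumr_ge0 => j _; exact: sqr_ge0.
have {}H t : 0 <= t ^+ 2 * B - 2 * t * A.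
  have := H t; rewrite [X in _ <= X](_ : _ =
    \sum_j x j ^+ 2 + (t ^+ 2 * B - 2 * t * A)); first by rewrite lerDl.
  rewrite /A /B !mulr_sumr -sumrN -!big_split/=.
  by apply: eq_bigr => j _; ring.
apply/eqP; rewrite -/A -sqrf_eq0 eq_le sqr_ge0 andbT.
(* The optimal step would be [A / B]; adding 1 avoids a zero denominator and still makes the
   quadratic negative unless [A = 0]. *)
have := H (A / (B + 1)).
have B1 : 0 < B + 1 by rewrite ltr_wpDl.
rewrite (_ : _ - _ = - (A ^+ 2 * ((B + 2) / (B + 1) ^+ 2))); last first.
  by field; rewrite gt_eqF.
rewrite oppr_ge0 pmulr_lle0// divr_gt0// ?exprn_gt0//.
by rewrite ltr_wpDl.
Qed.

Variable q0 : forall i, 'I_(n i).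

Definition env_gram s (u : U R s n) (i : 'I_d) :=
  gram (fun j : index => j i == q0 i) (env u i).

Definition env_cross r s (w : U R r n) (u : U R s n) (i : 'I_d) c a :=
  \sum_(j : index | j i == q0 i) env w i c j * env u i a j.

Definition env_free s (u : U R s n) i :=
  fam_free (fun j : index => j i == q0 i) (env u i).

(* For the least squares problem in the [i]-th core with target [tau w]. *)
Definition normal_eq r s (w : U R r n) (u : U R s n) i (v : core R s (n i)) :=
  forall q a, \sum_c w i c.1 q c.2 * env_cross w u i c a =
              \sum_b v b.1 q b.2 * env_gram u i b a.

Lemma slice_tau r s (w : U R r n) (u : U R s n) i q a :
  \sum_(j : index | j i == q) tau w j * env u i a j =
  \sum_c w i c.1 q c.2 * env_cross w u i c a.
Proof.
transitivity (\sum_(j : index | j i == q)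
    \sum_c w i c.1 q c.2 * (env w i c j * env u i a j)).
  apply: eq_bigr => j /eqP jq; rewrite (tau_env w i) jq mulr_suml.
  by apply: eq_bigr => c _; rewrite mulrA.
rewrite exchange_big/=; apply: eq_bigr => c _; rewrite -mulr_sumr.
congr (_ * _); apply: slice_sum => j j' jj'.
by congr (_ * _); exact: env_index.
Qed.

Lemma slice_dfwith s (u : U R s n) i (v : core R s (n i)) q a :
  \sum_(j : index | j i == q) tau (eqtype.dfwith u v) j * env u i a j =
  \sum_b v b.1 q b.2 * env_gram u i b a.
Proof.
rewrite (slice_tau (eqtype.dfwith u v) u); rewrite eqtype.dfwith_in.
apply: eq_bigr => b _; congr (_ * _); rewrite /env_cross /env_gram /gram.
rewrite (@env_ext _ _ _ s _ u)// => l li.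
by rewrite eqtype.dfwith_out// eq_sym.
Qed.

(** The residual is orthogonal to every direction in which the core can move the network: entry
    [(a.1, q, a.2)] moves it along environment [a] restricted to slice [q]. *)
Lemma normal_eq_min r s (w : U R r n) (u : U R s n) i (v : core R s (n i)) :
  is_minimizer (fun v => objective (tau w) (eqtype.dfwith u v)) v ->
  normal_eq w u v.
Proof.
move=> vmin q a; apply/eqP; rewrite -subr_eq0 -slice_tau -slice_dfwith; apply/eqP.
rewrite -sumrB.
pose e (j : index) := (j i == q)%:R * env u i a j.
pose x j := tau w j - tau (eqtype.dfwith u v) j.
transitivity (\sum_j x j * e j).
  rewrite [LHS]big_mkcond; apply: eq_bigr => j _; rewrite /x /e.
  by case: eqP => _; rewrite ?mul1r ?mul0r ?mulr0// mulrBl.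
apply: orthogonal_of_min => t.
pose vt : core R s (n i) := fun k p k' =>
  v k p k' + t * ((p == q)%:R * ((k, k') == a)%:R).
have := vmin vt; rewrite !objectiveE ler_pM2l ?invr_gt0//.
rewrite [X in _ <= X](eq_bigr (fun j => (x j - t * e j) ^+ 2))// => j _.
congr (_ ^+ 2); rewrite /x -addrA; congr (_ + _); rewrite -opprD; congr (- _).
rewrite !tau_dfwith /e /vt.
under eq_bigr do rewrite mulrDl.
rewrite big_split/=; congr (_ + _); rewrite (bigD1 a)//= -surjective_pairing eqxx.
rewrite mulr1 big1 ?addr0 ?mulrA// => b ba.
by rewrite -surjective_pairing (negbTE ba) !mulr0 mul0r.
Qed.

Lemma normal_eq_exact r s (w : U R r n) (u : U R s n) i :
  tau u = tau w -> normal_eq w u (u i).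
Proof.
move=> uw q a; rewrite -slice_tau -uw slice_tau.
by [].
Qed.

End NormalEquations.

(** * The division-free loop and its Gram determinants *)

Section Iteration.
Variables (R : realType) (d : nat) (n : 'I_d -> nat) (r s : nat).
Variables (q0 : forall i, 'I_(n i)) (w : U R r n).
Arguments w : clear implicits.
Implicit Types (u v : U R s n).

Definition normal_rhs u (i : 'I_d) (q : 'I_(n i)) a : R :=
  \sum_c w i c.1 q c.2 * env_cross q0 w u i c a.

Lemma normal_eq_uniq u i (v v' : core R s (n i)) : env_free q0 u i ->
  normal_eq q0 w u v -> normal_eq q0 w u v' -> v = v'.
Proof.
move=> /gram_free/fdet_neq0P uG vE v'E.
apply/funext => k; apply/funext => q; apply/funext => k'.
apply/eqP; rewrite -subr_eq0; apply/eqP.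
apply: (uG (fun a => v a.1 q a.2 - v' a.1 q a.2) _ (k, k')) => b.
under eq_bigr do rewrite mulrBl.
by rewrite sumrB -[X in X - _]vE v'E subrr.
Qed.

(* The solution of the normal equations times the Gram determinant, which makes
   it polynomial in the cores. *)
Definition core_update u (i : 'I_d) : core R s (n i) := fun k q k' =>
  \sum_a normal_rhs u q a * fadj (env_gram q0 u i) a (k, k').
Arguments core_update : clear implicits.

Lemma core_updateE u i q b :
  \sum_a core_update u i a.1 q a.2 * env_gram q0 u i a b =
  fdet (env_gram q0 u i) * normal_rhs u q b.
Proof.
rewrite -fadj_solve; apply: eq_bigr => a _; congr (_ * _).
by apply: eq_bigr => e _; rewrite -surjective_pairing.
Qed.

Lemma core_update_solve u i : env_free q0 u i ->
  normal_eq q0 w u (fun k q k' =>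
    (fdet (env_gram q0 u i))^-1 * core_update u i k q k').
Proof.
move=> /gram_free uG q a; under [RHS]eq_bigr do rewrite -mulrA.
by rewrite -mulr_sumr core_updateE mulKf.
Qed.

(** In the solution formula [q] enters only through the fibres of [w i]. *)
Lemma normal_eq_span u i (v : core R s (n i)) : env_free q0 u i ->
  normal_eq q0 w u v ->
  exists C : 'I_s * 'I_s -> 'I_r * 'I_r -> R,
    forall k q k', v k q k' = \sum_c C (k, k') c * w i c.1 q c.2.
Proof.
move=> uf vE; rewrite (normal_eq_uniq uf vE (core_update_solve uf)).
exists (fun b c => (fdet (env_gram q0 u i))^-1 *
  \sum_a env_cross q0 w u i c a * fadj (env_gram q0 u i) a b) => k q k'.
rewrite /core_update /normal_rhs; under eq_bigr do rewrite mulr_suml.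
rewrite exchange_big/= mulr_sumr; apply: eq_bigr => c _.
rewrite -mulrA; congr (_ * _); rewrite mulr_suml; apply: eq_bigr => a _.
by rewrite -mulrA mulrC.
Qed.

(** The loop with division-free updates, so that the cores stay polynomial in [u]. After [d] steps
    no site is left and nothing changes. *)
Fixpoint iterate u (m : nat) : U R s n :=
  if m is m'.+1 then
    if insub m' is Some i then
      eqtype.dfwith (iterate u m') (core_update (iterate u m') i)
    else iterate u m'
  else u.

(** The state before microstep [m] of a loop leading from [u] to [v]. *)
Definition sweep u v (m : nat) : U R s n := fun i => if (i < m)%N then v i else u i.

Arguments iterate : clear implicits.
Arguments sweep : clear implicits.

Definition iterate_dets u : R :=
  \prod_(i < d) fdet (env_gram q0 (iterate u i) i).

Lemma env_free_scale u v i (c : R) : c != 0 ->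
  (forall a j, env u i a j = c * env v i a j) ->
  env_free q0 u i <-> env_free q0 v i.
Proof.
move=> c0 uv; have E (x : 'I_s * 'I_s -> R) j :
    \sum_a x a * env u i a j = c * \sum_a x a * env v i a j.
  by rewrite mulr_sumr; apply: eq_bigr => a _; rewrite uv mulrCA.
split=> H x xE; apply: H => j /xE.
  by rewrite E => ->; rewrite mulr0.
by rewrite E => /eqP; rewrite mulf_eq0 (negbTE c0) => /eqP.
Qed.

(** Free environments make each least squares solution unique, so true and division-free cores
    differ only by nonzero scalars, which are tracked through the loop. *)
Lemma sweep_iterate u v (m : nat) : (m <= d)%N ->
  (forall i : 'I_d, normal_eq q0 w (sweep u v i) (v i)) ->
  (forall i : 'I_d, (i < m)%N -> env_free q0 (iterate u i) i) ->
  exists2 c : 'I_d -> R, (forall i, c i != 0) &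
    forall i a q b, sweep u v m i a q b = c i * iterate u m i a q b.
Proof.
move=> md vE; elim: m md => [_ _|m IHm md uf].
  by exists (fun=> 1) => [i|i a q b]; rewrite ?oner_eq0// mul1r.
have [i im|c c0 cE] := IHm (ltnW md); first by apply: uf; rewrite ltnS ltnW.
pose i := Ordinal md.
have {}uf : env_free q0 (iterate u m) i by exact: (uf i).
pose g := \prod_(l | l != i) c l.
have g0 : g != 0 by apply/prodf_neq0 => l _; exact: c0.
have gE a j : env (sweep u v m) i a j = g * env (iterate u m) i a j.
  by apply: env_scale => l _; exact: cE.
pose D := fdet (env_gram q0 (iterate u m) i).
have D0 : D != 0 by exact/gram_free.
(* Scaling the environments by [g] scales the cross terms by [g] and the Gram matrix by [g ^ 2], so
   [g * v i] solves the unscaled equations. Hence the factor [(g * D)^-1] for the new core. *)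
have E : normal_eq q0 w (iterate u m) (fun k q k' => g * v i k q k').
  move=> q a; apply: (mulfI g0).
  transitivity (\sum_c w i c.1 q c.2 * env_cross q0 w (sweep u v m) i c a).
    rewrite mulr_sumr; apply: eq_bigr => e _; rewrite mulrCA; congr (_ * _).
    by rewrite mulr_sumr; apply: eq_bigr => j _; rewrite gE mulrCA.
  rewrite (vE i q a) mulr_sumr; apply: eq_bigr => b _.
  rewrite /env_gram /gram !mulr_sumr; apply: eq_bigr => j _.
  by rewrite !gE; ring.
have {}E := normal_eq_uniq uf E (core_update_solve uf).
exists (fun l => if l == i then (g * D)^-1 else c l) => [l|l a q b].
  by case: ifP => // _; rewrite invr_eq0 mulf_neq0.
rewrite /= (insubT (fun k => k < d)%N md) -/i.
move: a q b; have [->|li] := eqVneq l i => a q b.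
  rewrite eqtype.dfwith_in /sweep ltnSn.
  have /(congr1 (fun f => f a q b)) := E; rewrite -/D => Eabq.
  apply: (mulfI g0); rewrite Eabq mulrA; congr (_ * _).
  by rewrite invfM mulrA mulfV// mul1r.
rewrite eqtype.dfwith_out 1?eq_sym// -cE /sweep ltnS leq_eqVlt.
suff /negbTE -> : nat_of_ord l != m by [].
by apply: contra li => /eqP lm; apply/eqP/val_inj.
Qed.

Lemma sweep_free_of_dets u v :
  (forall i : 'I_d, normal_eq q0 w (sweep u v i) (v i)) ->
  iterate_dets u != 0 -> forall i : 'I_d, env_free q0 (sweep u v i) i.
Proof.
move=> vE /prodf_neq0 D0 i.
have [i' _|c c0 cE] := @sweep_iterate u v i (ltnW (ltn_ord i)) vE.
  by apply/gram_free; exact: D0.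
apply/(@env_free_scale _ (iterate u i) i (\prod_(l | l != i) c l)).
- by apply/prodf_neq0 => l _; exact: c0.
- by apply: env_scale => l _; exact: cE.
- by apply/gram_free; exact: D0.
Qed.

(** Strong induction on the site: free environments at the earlier iterates allow the comparison
    with the sweep, which passes freeness on to the current iterate. *)
Lemma dets_of_sweep_free u v :
  (forall i : 'I_d, normal_eq q0 w (sweep u v i) (v i)) ->
  (forall i : 'I_d, env_free q0 (sweep u v i) i) -> iterate_dets u != 0.
Proof.
move=> vE vf; apply/prodf_neq0 => i _; apply/gram_free.
have [m mi] := ubnP (nat_of_ord i); elim: m i mi => // m IHm i im.
have [i' i'i|c c0 cE] := @sweep_iterate u v i (ltnW (ltn_ord i)) vE.
  by apply: IHm; exact: leq_trans i'i im.
apply/(@env_free_scale (sweep u v i) _ i (\prod_(l | l != i) c l)) => //.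
- by apply/prodf_neq0 => l _; exact: c0.
- by apply: env_scale => l _; exact: cE.
Qed.

End Iteration.

Arguments sweep {R d n s} u v m i.

(** * Exact solvability at one site by a dimension count *)

Section Span.
Variables (R : realType) (d : nat) (n : 'I_d -> nat) (r : nat).
Variables (w : U R r n) (i : 'I_d) (c0 : 'I_r * 'I_r).
Arguments w : clear implicits.
Local Notation index := {dffun forall i : 'I_d, 'I_(n i)}.
Local Notation labels := {ffun 'I_d -> 'I_r * 'I_r}.

(* One pair of bond indices for each site other than [i]. *)
Definition off_labels : {pred labels} := pffun_on c0 (predC1 i) predT.

Definition slice_prod (f : labels) (j : index) : R :=
  \prod_(l | l != i) w l (f l).1 (j l) (f l).2.

(** Coordinates of environment [a] in the products [slice_prod], when fibre [(k, k')] of core [l]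
    has coordinates [C l (k, k')] in the fibres of [w l]. *)
Definition env_coef s (C : 'I_d -> 'I_s * 'I_s -> 'I_r * 'I_r -> R) a f : R :=
  \sum_(k : {ffun 'I_d -> 'I_s} | (k i, k (ordS i)) == a)
    \prod_(l | l != i) C l (k l, k (ordS l)) (f l).

Lemma env_expand s (u : U R s n) C :
  (forall l, l != i -> forall k q k',
     u l k q k' = \sum_c C l (k, k') c * w l c.1 q c.2) ->
  forall a j, env u i a j =
    \sum_(f in off_labels) env_coef C a f * slice_prod f j.
Proof.
move=> uC a j; under [RHS]eq_bigr do rewrite mulr_suml.
rewrite exchange_big/=; apply: eq_bigr => k _.
under eq_bigr => l li do rewrite uC//.
rewrite (big_distr_big c0); apply: eq_bigr => f _.
by rewrite -big_split.
Qed.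

(** The count makes [env_coef C] square, and a relation between its rows would be one between the
    environments of [u]. Its inverse expresses each [slice_prod] by these environments, hence also
    the environments of [w], which core [i] has to match. *)
Lemma exact_core s (q0 : forall l, 'I_(n l)) (u : U R s n) :
  (s ^ 2 = (r ^ 2) ^ d.-1)%N ->
  (forall l, l != i -> exists C : 'I_s * 'I_s -> 'I_r * 'I_r -> R,
     forall k q k', u l k q k' = \sum_c C (k, k') c * w l c.1 q c.2) ->
  env_free q0 u i ->
  exists v : core R s (n i), tau (eqtype.dfwith u v) = tau w.
Proof.
move=> srd uw ufree.
have /choice[C CE] : forall l, exists C : 'I_s * 'I_s -> 'I_r * 'I_r -> R,
    l != i -> forall k q k', u l k q k' = \sum_c C (k, k') c * w l c.1 q c.2.
  move=> l; have [->|/uw[C CE]] := eqVneq l i; last by exists C.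
  by exists (fun=> fun=> 0).
have uE := env_expand CE.
have [||N NE] := @square_left_inverse R ('I_s * 'I_s)%type labels off_labels (env_coef C).
- rewrite card_pffun_on [X in (X ^ _)%N](_ : _ = (r ^ 2)%N); last first.
    by rewrite -[LHS]/#|{: 'I_r * 'I_r}| card_prod card_ord mulnn.
  by rewrite card_prod !card_ord mulnn srd cardC1 card_ord.
- move=> c cM; apply: ufree => j _; under eq_bigr do rewrite uE mulr_sumr.
  rewrite exchange_big big1//= => f fP; under eq_bigr do rewrite mulrA.
  by rewrite -mulr_suml cM ?mul0r.
have slice_env f j : f \in off_labels ->
    slice_prod f j = \sum_a N f a * env u i a j.
  move=> fP; under eq_bigr do rewrite uE mulr_sumr.
  rewrite exchange_big/= (bigD1 f)//= [X in _ + X]big1 ?addr0 => [|g /andP[gP gf]].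
    under eq_bigr do rewrite mulrA.
    by rewrite -mulr_suml NE// eqxx mul1r.
  under eq_bigr do rewrite mulrA.
  by rewrite -mulr_suml NE// eq_sym (negbTE gf) mul0r.
have wE := @env_expand r w (fun _ b c => (b == c)%:R).
pose D c f := env_coef (fun _ (b c : 'I_r * 'I_r) => (b == c)%:R) c f.
exists (fun k q k' => \sum_c w i c.1 q c.2 *
  \sum_(f in off_labels) D c f * N f (k, k')).
apply/funext => j; rewrite tau_dfwith (tau_env w i).
under eq_bigr do rewrite mulr_suml.
rewrite exchange_big/=; apply: eq_bigr => c _.
under eq_bigr => a _ do rewrite -surjective_pairing -mulrA.
rewrite -mulr_sumr wE => [|l _ k q k']; last first.
  rewrite (bigD1 (k, k'))//= eqxx mul1r big1 ?addr0// => b.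
  by rewrite eq_sym => /negbTE ->; rewrite mul0r.
congr (_ * _); under eq_bigr do rewrite mulr_suml.
rewrite exchange_big/=; apply: eq_bigr => f fP; rewrite slice_env// mulr_sumr.
by apply: eq_bigr => a _; rewrite mulrA.
Qed.

End Span.

(** * A fixed point with free environments *)

Section CyclicPosition.
Variables (d : nat) (i : 'I_d).

(* The position of [b] along the cycle, starting just after [i]. *)
Definition cyc_pos (b : 'I_d) : nat := (b + (d - i.+1)) %% d.

Lemma cyc_pos_start : cyc_pos (ordS i) = 0%N.
Proof. by rewrite /cyc_pos /= modnDml subnKC ?modnn. Qed.

Lemma cyc_pos_end : cyc_pos i = d.-1.
Proof.
have id := ltn_ord i; rewrite /cyc_pos modn_small; last by lia.
by lia.
Qed.

Lemma cyc_pos_lt b : (cyc_pos b < d)%N.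
Proof. by rewrite ltn_mod (leq_ltn_trans _ (ltn_ord i)). Qed.

Lemma cyc_pos_inj : injective cyc_pos.
Proof.
move=> b c /eqP; rewrite eqn_modDr !modn_small ?ltn_ord// => /eqP.
exact: val_inj.
Qed.

Lemma cyc_posS b : b != i -> cyc_pos (ordS b) = (cyc_pos b).+1.
Proof.
move=> bi; have bl := cyc_pos_lt b.
have bd : cyc_pos b != d.-1.
  by rewrite -cyc_pos_end (inj_eq cyc_pos_inj).
rewrite {1}/cyc_pos /= modnDml addSn -addn1 -modnDml -/(cyc_pos b) addn1.
by rewrite modn_small//; lia.
Qed.

End CyclicPosition.

Lemma ord_pred_neq d (i : 'I_d) : (2 <= d)%N -> ord_pred i != i.
Proof.
move=> d2; apply/eqP => /(congr1 val) /=; have := ltn_ord i.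
case: (posnP i) => [->|i0] id; first by rewrite add0n modn_small; lia.
rewrite (_ : (i + d).-1 = (i.-1 + d)%N); last by lia.
by rewrite modnDr modn_small; lia.
Qed.

(** * The exact network with free environments *)

Section Witness.
Variables (R : realType) (d r m : nat) (n : 'I_d -> nat) (z0 : 'I_r).
Variable w : U R r n.
Arguments w : clear implicits.
Local Notation index := {dffun forall i : 'I_d, 'I_(n i)}.
Local Notation labels := {ffun 'I_d -> 'I_r}.
Hypothesis d2 : (2 <= d)%N.
(* The state of bond [b], between the sites [ord_pred b] and [b], is a label for
   each bond but one: [dec b] enumerates the labels vanishing at [ord_pred b]. *)
Variables (dec : 'I_d -> 'I_m -> labels) (enc : 'I_d -> labels -> 'I_m).
Hypothesis decK : forall b, cancel (dec b) (enc b).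
Hypothesis encK : forall b (f : labels), f (ord_pred b) = z0 -> dec b (enc b f) = f.
Hypothesis dec0 : forall b k, dec b k (ord_pred b) = z0.

Let decS0 b k : dec (ordS b) k b = z0.
Proof. by have := dec0 (ordS b) k; rewrite ordSK. Qed.

Definition agree (s : 'I_d) (f g : labels) :=
  [forall l, (l != ord_pred s) && (l != s) ==> (f l == g l)].

Lemma agreeP s (f g : labels) :
  reflect (forall l, l != ord_pred s -> l != s -> f l = g l) (agree s f g).
Proof.
apply: (iffP forallP) => [H l ls ls'|H l]; last first.
  by apply/implyP => /andP[ls ls']; apply/eqP/H.
by have := H l; rewrite ls ls' => /eqP.
Qed.

(* Site [s] consumes the label [s] of its left bond, creates the label
   [ord_pred s] of its right bond, and passes the others unchanged. *)
Definition witness : U R m n := fun s k q k' =>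
  (agree s (dec s k) (dec (ordS s) k'))%:R *
  w s (dec (ordS s) k' (ord_pred s)) q (dec s k s).
Arguments witness : clear implicits.

Section WitnessEnv.
Variables (i : 'I_d) (k k' : 'I_m).
Let y := dec i k.
Let x := dec (ordS i) k'.
Local Notation pos := (cyc_pos i).

(** The state forced on bond [b] when bonds [i] and [ordS i] are in states [k] and [k']. Going
    around from [ordS i], label [l] keeps its initial value [x l] until site [l] consumes it, and
    has its final value [y l] once site [ordS l] has created it anew. *)
Definition chain_label (b : 'I_d) : labels := [ffun l =>
  if l == ord_pred b then z0
  else if (pos (ordS l) < pos b)%N then y l else x l].

Definition chain : {ffun 'I_d -> 'I_m} := [ffun b => enc b (chain_label b)].

Lemma posS_eq l b : (pos (ordS l) == pos b) = (l == ord_pred b).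
Proof.
rewrite (inj_eq (@cyc_pos_inj _ i)).
by apply/eqP/eqP => [<-|->]; rewrite ?ordSK ?ord_predK.
Qed.

Lemma dec_chain b : dec b (chain b) = chain_label b.
Proof. by rewrite ffunE encK// ffunE eqxx. Qed.

Lemma chain_start : chain i = k.
Proof.
rewrite -[LHS](decK i) dec_chain -[RHS](decK i); congr enc.
apply/ffunP => l; rewrite ffunE; case: eqVneq => [->|li]; first by rewrite dec0.
rewrite ifT//; have := cyc_pos_lt i (ordS l).
by move: li; rewrite -posS_eq cyc_pos_end; lia.
Qed.

Lemma chain_end : chain (ordS i) = k'.
Proof.
rewrite -[LHS](decK (ordS i)) dec_chain -[RHS](decK (ordS i)); congr enc.
apply/ffunP => l; rewrite ffunE; case: eqVneq => [->|li]; first by rewrite dec0.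
by rewrite cyc_pos_start ltn0.
Qed.

Lemma chain_agree s : s != i -> agree s (chain_label s) (chain_label (ordS s)).
Proof.
move=> si; apply/agreeP => l ls ls'; rewrite !ffunE ordSK.
rewrite (negbTE ls) (negbTE ls') (cyc_posS si) ltnS [(pos (ordS l) <= pos s)%N]leq_eqVlt posS_eq.
by rewrite (negbTE ls).
Qed.

Lemma chain_uniq (K : {ffun 'I_d -> 'I_m}) : K i = k -> K (ordS i) = k' ->
  (forall s, s != i -> agree s (dec s (K s)) (dec (ordS s) (K (ordS s)))) ->
  K = chain.
Proof.
move=> Kk Kk' Ka; apply/ffunP => b; rewrite -[LHS](decK b) [RHS]ffunE; congr enc.
(* Forward from bond [ordS i], by induction on the position. *)
have above : forall p b l, pos b = p -> (p < pos (ordS l))%N -> dec b (K b) l = x l.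
  elim=> [|p IHp] {}b l bp pl.
    by move: bp; rewrite -(@cyc_pos_start _ i) => /cyc_pos_inj ->; rewrite Kk'.
  have bi : ord_pred b != i.
    by apply/eqP => bi; move: bp; rewrite -[b]ord_predK bi cyc_pos_start.
  have b'p : pos (ord_pred b) = p.
    by move: bp; rewrite -{1}[b]ord_predK (cyc_posS bi) => -[].
  rewrite -(IHp (ord_pred b) l b'p (ltnW pl)).
  have := Ka _ bi; rewrite ord_predK => /agreeP -> //.
    by rewrite -posS_eq b'p; lia.
  by rewrite -posS_eq bp; lia.
(* Backward from bond [i], by induction on the distance to it. *)
have below : forall p b l, (d.-1 - pos b = p)%N -> (pos (ordS l) < pos b)%N ->
    dec b (K b) l = y l.
  elim=> [|p IHp] {}b l bp lb.
    have : pos b = pos i by rewrite cyc_pos_end; have := cyc_pos_lt i b; lia.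
    by move=> /cyc_pos_inj ->; rewrite Kk.
  have bi : b != i by apply/eqP => bi; move: bp; rewrite bi cyc_pos_end; lia.
  have bS := cyc_posS bi.
  have /agreeP -> := Ka _ bi; first by rewrite (IHp (ordS b) l) ?bS//; lia.
    by rewrite -posS_eq; lia.
  by apply/eqP => lb'; move: lb; rewrite lb' bS; lia.
apply/ffunP => l; rewrite ffunE; case: eqVneq => [->|lb]; first by rewrite dec0.
case: ltngtP => [lb'|lb'|/eqP]; last by rewrite posS_eq (negbTE lb).
  by rewrite (below _ b l erefl).
by rewrite (above _ b l erefl).
Qed.

(** Only the state [chain] respects the agreements at all sites other than [i], so a single product
    of fibres survives. *)
Lemma env_witness j :
  env witness i (k, k') j = \prod_(s | s != i) w s (y (ord_pred s)) (j s) (x s).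
Proof.
rewrite /env (bigD1 chain)/=; last by rewrite chain_start chain_end.
rewrite [X in _ + X]big1 ?addr0 => [|K /andP[/eqP[Kk Kk'] Kc]].
  apply: eq_bigr => s si; rewrite /witness !dec_chain chain_agree// mul1r.
  rewrite !ffunE ordSK (negbTE (ord_pred_neq _ d2)) eq_sym.
  rewrite (negbTE (ord_pred_neq _ d2)) ord_predK (cyc_posS si) ltnSn.
  by rewrite ltnNge leqnSn.
have [/forallP H|/forallPn[s]] := boolP [forall s, (s != i) ==>
    agree s (dec s (K s)) (dec (ordS s) (K (ordS s)))].
  case/eqP: Kc; apply: chain_uniq => // s si.
  by have := H s; rewrite si.
rewrite negb_imply => /andP[si /negbTE sa].
by rewrite (bigD1 s)//= /witness sa !mul0r.
Qed.

End WitnessEnv.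

(** Pairs of states on the two bonds of site [i] that agree there correspond to labelings of all
    bonds of [w], and each contributes the matching term of [tau w]. *)
Lemma tau_witness : tau witness = tau w.
Proof.
pose i : 'I_d := Ordinal (ltnW d2).
apply/funext => j; rewrite (tau_env _ i).
pose G (z : labels) := \prod_s w s (z (ord_pred s)) (j s) (z s).
transitivity (\sum_z G z); last first.
  rewrite /tau /outer_product.
  (* Label [l] is the bond of [w] leaving site [l], whereas [tau] names a bond by the site it
     enters. *)
  rewrite [RHS](reindex (fun z : labels => [ffun s => z (ord_pred s)])).
    apply: eq_bigr => z _; apply: eq_bigr => s _.
    by rewrite !ffunE ordSK.
  exists (fun z : labels => [ffun s => z (ordS s)]) => z _;
    by apply/ffunP => s; rewrite !ffunE ?ordSK ?ord_predK.
pose del (l : 'I_d) (z : labels) : labels := [ffun s => if s == l then z0 else z s].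
pose split (z : labels) := (enc i (del (ord_pred i) z), enc (ordS i) (del i z)).
have decl z : dec i (enc i (del (ord_pred i) z)) = del (ord_pred i) z.
  by rewrite encK// ffunE eqxx.
have decr z : dec (ordS i) (enc (ordS i) (del i z)) = del i z.
  by rewrite encK// ffunE ordSK eqxx.
(* Label [i] is read on the left bond of site [i], as the right bond has the dummy [z0] there; all
   others are read on the right bond. *)
pose glue (a : 'I_m * 'I_m) : labels :=
  [ffun l => if l == i then dec i a.1 i else dec (ordS i) a.2 l].
have ip := ord_pred_neq i d2.
rewrite (bigID (fun a => agree i (dec i a.1) (dec (ordS i) a.2)))/=.
rewrite [X in _ + X]big1 ?addr0 => [|a /negbTE aF]; last first.
  by rewrite /witness aF !mul0r.
rewrite (reindex_onto split glue)/=; last first.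
  move=> [k k'] /= /agreeP ka; rewrite /split.
  rewrite -[in RHS](decK i k) -[in RHS](decK (ordS i) k').
  congr (enc _ _, enc _ _); apply/ffunP => l; rewrite !ffunE/=.
    case: eqVneq => [->|li]; first by rewrite dec0.
    by case: eqVneq => [->//|li']; rewrite ka.
  by case: eqVneq => // ->; rewrite decS0.
apply: eq_big => [z|z _].
  rewrite decl decr; apply/andP; split.
    by apply/agreeP => l ll li; rewrite !ffunE (negbTE ll) (negbTE li).
  apply/eqP/ffunP => l; rewrite !ffunE /= decl decr !ffunE [i == _]eq_sym (negbTE ip).
  by case: eqVneq => // ->.
rewrite /split env_witness /witness decl decr /G [RHS](bigD1 i)//=.
rewrite !ffunE (negbTE ip) [i == _]eq_sym (negbTE ip).
rewrite (_ : agree _ _ _); last first.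
  by apply/agreeP => l ll li; rewrite !ffunE (negbTE ll) (negbTE li).
rewrite mul1r; congr (_ * _); apply: eq_bigr => s si.
rewrite !ffunE (negbTE si) ifF//; apply/negbTE; apply: contra si.
by move/eqP/(can_inj (@ord_predK _)) => ->.
Qed.

(** The environments are products of fibres, so the product [phi] of dual fibres pairs to 1 with
    environment [(k, k')] and to 0 with all others, isolating its coefficient. *)
Lemma witness_free (q0 : forall l, 'I_(n l)) i :
  (forall l, fam_free xpredT (fun (b : 'I_r * 'I_r) q => w l b.1 q b.2)) ->
  env_free q0 witness i.
Proof.
move=> wf.
pose g l := sval (cid (free_dual (wf l))).
have gE l a b : \sum_q g l a q * w l b.1 q b.2 = (a == b)%:R.
  exact: (svalP (cid (free_dual (wf l)))).
move=> c cE [k k'].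
pose y := dec i k; pose x := dec (ordS i) k'.
pose phi (j : index) := \prod_(s | s != i) g s (y (ord_pred s), x s) (j s).
have E : \sum_(j : index | j i == q0 i) phi j * (\sum_a c a * env witness i a j) = 0.
  by apply: big1 => j /cE ->; rewrite mulr0.
rewrite -E; under eq_bigr do rewrite mulr_sumr.
rewrite exchange_big/= (bigD1 (k, k'))//= [X in _ + X]big1 ?addr0 => [|[l l'] ll'].
  under eq_bigr do rewrite mulrCA env_witness -big_split/=.
  rewrite -mulr_sumr (sum_prod_slice _ (fun s q =>
    g s (y (ord_pred s), x s) q * w s (y (ord_pred s)) q (x s))).
  rewrite big1 ?mulr1// => s _.
  by rewrite (gE s _ (y (ord_pred s), x s)) eqxx.
under eq_bigr do rewrite mulrCA env_witness -big_split/=.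
rewrite -mulr_sumr (sum_prod_slice _ (fun s q =>
  g s (y (ord_pred s), x s) q *
  w s (dec i l (ord_pred s)) q (dec (ordS i) l' s))).
apply/eqP; rewrite mulf_eq0; apply/orP; right.
apply/prodf_eq0.
(* The sites other than [i] read every label of [y] and [x] except those fixed to [z0], so distinct
   pairs differ at some site. *)
have [/forallP H|/forallPn[s]] := boolP [forall s, (s != i) ==>
    ((y (ord_pred s) == dec i l (ord_pred s)) && (x s == dec (ordS i) l' s))].
  case/eqP: ll'; congr (_, _).
    apply: (can_inj (decK i)); apply/ffunP => s.
    have [si|si] := eqVneq (ordS s) i; first by rewrite -[s]ordSK si !dec0.
    by have := H (ordS s); rewrite si ordSK => /andP[/eqP].
  apply: (can_inj (decK (ordS i))); apply/ffunP => s.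
  have [->|si] := eqVneq s i; first by rewrite !decS0.
  by have := H s; rewrite si => /andP[_ /eqP].
rewrite negb_imply => /andP[si sF]; exists s => //.
rewrite (gE s _ (dec i l (ord_pred s), dec (ordS i) l' s)) xpair_eqE.
by rewrite (negbTE sF).
Qed.

End Witness.

(** * Genericity *)

(** With the value at [p] prescribed, [d - 1] labels remain to choose, whence the bond size
    [r ^ d.-1]. *)
Lemma bond_labels (d r : nat) (z0 : 'I_r) (p : 'I_d) :
  exists de : ('I_(r ^ d.-1) -> {ffun 'I_d -> 'I_r}) *
              ({ffun 'I_d -> 'I_r} -> 'I_(r ^ d.-1)),
    [/\ cancel de.1 de.2, forall f : {ffun 'I_d -> 'I_r}, f p = z0 -> de.1 (de.2 f) = f &
        forall k, de.1 k p = z0].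
Proof.
pose A : {pred {ffun 'I_d -> 'I_r}} := [pred f : {ffun _ -> _} | f p == z0].
have cA : #|A| = (r ^ d.-1)%N.
  transitivity #|pffun_on z0 (predC1 p) (@predT 'I_r)|.
    apply: eq_card => f; apply/eqP/pffun_onP => [fp|[/supportP fA _]].
      by split=> //; apply/supportP => l; rewrite !inE negbK => /eqP ->.
    by apply: fA; rewrite !inE eqxx.
  by rewrite card_pffun_on cardC1 !card_ord.
have A0 : [ffun=> z0] \in A by rewrite inE ffunE.
exists (fun k => enum_val (cast_ord (esym cA) k), fun f => cast_ord cA (enum_rank_in A0 f)).
split=> [k|f fp|k] /=.
- by rewrite enum_valK_in cast_ordKV.
- by rewrite cast_ordK enum_rankK_in//; exact/eqP.
- by apply/eqP; exact: (enum_valP (cast_ord (esym cA) k)).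
Qed.

Section Polynomiality.
Variables (R : realType) (I : finType).

Lemma polyfun_fdet (A : finType) (M : (I -> R) -> A -> A -> R) :
  (forall a b, polyfun (fun x => M x a b)) -> polyfun (fun x => fdet (M x)).
Proof.
by move=> MP; apply: polyfun_det => i j; under eq_fun do rewrite mxE.
Qed.

Lemma polyfun_fadj (A : finType) (M : (I -> R) -> A -> A -> R) a b :
  (forall a b, polyfun (fun x => M x a b)) -> polyfun (fun x => fadj (M x) a b).
Proof.
by move=> MP; apply: polyfun_adj => i j; under eq_fun do rewrite mxE.
Qed.

Lemma polyfun_gram (A J : finType) (P : pred J) (f : (I -> R) -> A -> J -> R) :
  (forall a j, polyfun (fun x => f x a j)) ->
  forall a b, polyfun (fun x => gram P (f x) a b).
Proof. by move=> fP a b; apply: polyfun_sum => j _; exact: polyfunM. Qed.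

Variables (d : nat) (n : 'I_d -> nat) (q0 : forall i, 'I_(n i)).

Definition polycore s (u : (I -> R) -> U R s n) :=
  forall i k q k', polyfun (fun x => u x i k q k').

Lemma polyfun_env s (u : (I -> R) -> U R s n) i a j :
  polycore u -> polyfun (fun x => env (u x) i a j).
Proof.
by move=> uP; apply: polyfun_sum => k _; apply: polyfun_prod => l _; exact: uP.
Qed.

Lemma polycore_iterate r s (w : U R r n) (u : (I -> R) -> U R s n) m :
  polycore u -> polycore (fun x => iterate q0 w (u x) m).
Proof.
move=> uP; elim: m => [|m IHm] //= i k q k'.
case: insubP => [l _ _|_]; last exact: IHm.
move: q; have [->|li] := eqVneq i l => q; last first.
  by under eq_fun do rewrite eqtype.dfwith_out 1?eq_sym//; exact: IHm.
under eq_fun do rewrite eqtype.dfwith_in.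
apply: polyfun_sum => a _; apply: polyfunM.
  apply: polyfun_sum => c _; apply: polyfunM; first exact: polyfun_cst.
  apply: polyfun_sum => j _; apply: polyfunM; first exact: polyfun_cst.
  exact: polyfun_env.
by apply: polyfun_fadj; apply: polyfun_gram => b j; exact: polyfun_env.
Qed.

Lemma polyfun_iterate_dets r s (w : U R r n) (u : (I -> R) -> U R s n) :
  polycore u -> polyfun (fun x => iterate_dets q0 w (u x)).
Proof.
move=> uP; apply: polyfun_prod => i _; apply: polyfun_fdet.
by apply: polyfun_gram => a j; apply: polyfun_env; exact: polycore_iterate.
Qed.

End Polynomiality.

(** * Generic targets have free fibres *)

Section GenericTarget.
Variables (R : realType) (d r : nat) (n : 'I_d -> nat).
Hypotheses (d2 : (2 <= d)%N) (r1 : (1 <= r)%N) (hn : forall i, (r ^ 2 <= n i)%N).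

Definition core_family (w : U R r n) i (b : 'I_r * 'I_r) (q : 'I_(n i)) : R :=
  w i b.1 q b.2.

Definition core_dets (w : U R r n) : R :=
  \prod_i fdet (gram xpredT (@core_family w i)).

Lemma core_dets_neq0P w :
  core_dets w != 0 <-> forall i, fam_free xpredT (@core_family w i).
Proof.
split=> [/prodf_neq0 w0 i|wf]; first by apply/gram_free; exact: w0.
by apply/prodf_neq0 => i _; apply/gram_free.
Qed.

Definition W_lift (x : W_index r n -> R) : U R r n := fun i k q k' =>
  if insub (Tagged (fun i => 'I_r * 'I_(n i) * 'I_r)%type (k, q, k'))
    is Some t then x t else 0.

Lemma W_coordK w : W R r n w -> W_lift (W_coord w) = w.
Proof.
move=> wW; apply/functional_extensionality_dep => i.
apply/funext => k; apply/funext => q; apply/funext => k'.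
rewrite /W_lift; case: insubP => [t _ tE|]; first by rewrite /W_coord tE.
by rewrite /= -leqNgt => /wW ->.
Qed.

Definition pair_index (b : 'I_r * 'I_r) : nat := (b.1 * r + b.2)%N.

Lemma pair_index_inj : injective pair_index.
Proof.
move=> [a b] [a' b']; rewrite /pair_index /= => E.
have := congr1 (divn^~ r) E; rewrite !divnMDl// !divn_small// !addn0 => aa'.
have := congr1 (modn^~ r) E; rewrite !modnMDl !modn_small// => bb'.
by congr (_, _); apply: val_inj.
Qed.

Lemma pair_index_lt b : (pair_index b < r ^ 2)%N.
Proof.
have : (b.1.+1 * r <= r * r)%N by rewrite leq_mul2r ltn_ord orbT.
by rewrite mulSn -mulnn /pair_index; have := ltn_ord b.2; lia.
Qed.

(** A point of [W] where no core determinant vanishes: the fibres of each core are the first [r ^ 2]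
    standard basis vectors. *)
Definition unit_cores : U R r n := fun i k q k' =>
  (pair_index (k, k') == q)%:R.

Lemma unit_cores_W : W R r n unit_cores.
Proof.
move=> i k q k' rq; rewrite /unit_cores; case: eqP => // E.
by move: rq; rewrite -E leqNgt pair_index_lt.
Qed.

Lemma unit_cores_free i : fam_free xpredT (@core_family unit_cores i).
Proof.
move=> c cE b; have bn := leq_trans (pair_index_lt b) (hn i).
have := cE (Ordinal bn) isT; rewrite (bigD1 b)//= /core_family /unit_cores.
rewrite -surjective_pairing eqxx mulr1 big1 ?addr0// => e eb.
by rewrite -surjective_pairing (inj_eq pair_index_inj) (negbTE eb) mulr0.
Qed.

Lemma null_W_core_dets :
  null_W [set w : U R r n | W R r n w /\ core_dets w = 0].
Proof.
pose i0 : 'I_d := Ordinal (ltnW d2); pose k0 : 'I_r := Ordinal r1.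
have r20 : (0 < r ^ 2)%N by rewrite expn_gt0 r1.
have q00 := leq_trans r20 (hn i0).
pose t0 : W_index r n := Sub (Tagged (fun i => 'I_r * 'I_(n i) * 'I_r)%type
  (k0, Ordinal q00, k0)) r20.
apply: (@null_subset _ _ _ [set x | core_dets (W_lift x) = 0]).
  by move=> _ [w [wW w0] <-] /=; rewrite W_coordK.
apply: (@polyfun_null _ _ t0 _ (W_coord unit_cores)).
  apply: polyfun_prod => i _; apply: polyfun_fdet; apply: polyfun_gram => b q.
  rewrite /core_family /W_lift; case: insubP => [t _ _|_].
    exact: polyfun_proj.
  exact: polyfun_cst.
rewrite W_coordK; last exact: unit_cores_W.
by apply/core_dets_neq0P; exact: unit_cores_free.
Qed.

End GenericTarget.

(** * Generic starting points and the final microstep *)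

Section GenericStart.
Variables (R : realType) (d r : nat) (n : 'I_d -> nat).
Hypotheses (d2 : (2 <= d)%N) (r1 : (1 <= r)%N).
Variables (q0 : forall i, 'I_(n i)) (w : U R r n).
Hypothesis wf : forall i, fam_free xpredT (@core_family R d r n w i).
Local Notation m := (r ^ d.-1)%N.

Lemma iterate_dets_generic : exists u : U R m n, iterate_dets q0 w u != 0.
Proof.
pose z0 : 'I_r := Ordinal r1.
have /choice[de deP] := fun b : 'I_d => bond_labels z0 (ord_pred b).
have decK b : cancel (de b).1 (de b).2 by have [] := deP b.
have encK b (f : {ffun 'I_d -> 'I_r}) : f (ord_pred b) = z0 -> (de b).1 ((de b).2 f) = f.
  by have [_ + _] := deP b; exact.
have dec0 b k : (de b).1 k (ord_pred b) = z0 by have [] := deP b.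
pose u := witness w (fun b => (de b).1).
(* Sweeping the witness into itself changes nothing, so its own free environments are those of every
   microstep. *)
have uE (i : 'I_d) : sweep u u i = u.
  by apply/functional_extensionality_dep => l; rewrite /sweep; case: ifP.
exists u; apply: (@dets_of_sweep_free _ _ _ _ _ _ _ _ u) => i; rewrite uE.
  by apply: normal_eq_exact; exact: (tau_witness w d2 decK encK dec0).
exact: (witness_free d2 decK encK dec0).
Qed.

Lemma null_U_iterate_dets : null_U [set u : U R m n | iterate_dets q0 w u = 0].
Proof.
have [u u0] := iterate_dets_generic.
pose i0 : 'I_d := Ordinal (ltnW d2).
have m0 : (0 < m)%N by rewrite expn_gt0 r1.
pose t0 : coord_index m n := Tagged (fun i => 'I_m * 'I_(n i) * 'I_m)%type
  (Ordinal m0, q0 i0, Ordinal m0).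
pose lift (x : coord_index m n -> R) : U R m n := fun i k q k' =>
  x (Tagged (fun i => 'I_m * 'I_(n i) * 'I_m)%type (k, q, k')).
apply: (@null_subset _ _ _ [set x | iterate_dets q0 w (lift x) = 0]).
  by move=> _ [v v0 <-].
apply: (@polyfun_null _ _ t0 (fun x => iterate_dets q0 w (lift x)) (Defs.coord u)) => //.
by apply: polyfun_iterate_dets => i k q k'; exact: polyfun_proj.
Qed.

(** Before the last microstep all other cores have fibres in the spans of those of [w], so some last
    core reaches residual 0; the minimizing one does no worse. *)
Lemma sweep_minimizer (u0 u1 : U R m n) : iterate_dets q0 w u0 != 0 ->
  (forall i, als_microstep (tau w) u0 u1 i) ->
  is_minimizer (objective (tau w)) u1.
Proof.
move=> D0 step.
have u1E (i : 'I_d) : normal_eq q0 w (sweep u0 u1 i) (u1 i).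
  by apply: normal_eq_min; exact: step.
have u1f := sweep_free_of_dets u1E D0.
have last_lt : (d.-1 < d)%N by lia.
pose i : 'I_d := Ordinal last_lt.
have sE l : l != i -> sweep u0 u1 i l = u1 l.
  move=> li; rewrite /sweep ifT//=.
  by have := ltn_ord l; move: li; rewrite -val_eqE/=; lia.
pose k0 : 'I_r := Ordinal r1.
have [||v vE] := @exact_core _ _ _ _ w i (k0, k0) m q0 (sweep u0 u1 i) _ _ (u1f i).
- by rewrite expnAC.
- by move=> l li; rewrite sE//; exact: normal_eq_span (u1f l) (u1E l).
have u1i : eqtype.dfwith (sweep u0 u1 i) (u1 i) = u1.
  apply/functional_extensionality_dep => l.
  have [->|li] := eqVneq l i; first by rewrite eqtype.dfwith_in.
  by rewrite eqtype.dfwith_out 1?eq_sym// sE.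
have obj0 : objective (tau w) (eqtype.dfwith (sweep u0 u1 i) v) = 0.
  by rewrite objectiveE vE big1 ?mulr0// => j _; rewrite subrr expr0n.
move=> y; rewrite -[in leLHS]u1i; apply: (@le_trans _ _ 0).
  by rewrite -obj0; exact: (step i v).
rewrite objectiveE mulr_ge0// ?invr_ge0//; apply: sumr_ge0 => j _.
exact: sqr_ge0.
Qed.

End GenericStart.

Theorem theorem4p2 (R : realType) (d r : nat) (n : 'I_d -> nat)
    (hd : (2 <= d)%N) (hr : (1 <= r)%N) (hn : forall i, (r ^ 2 <= n i)%N) :
  exists Omega1 : set (U R r n),
    [/\ Omega1 `<=` W R r n, null_W Omega1 &
      forall w : U R r n, (W R r n `\` Omega1) w ->
      exists Omega2 : set (U R (r ^ d.-1) n),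
        null_U Omega2 /\
        forall u0 : U R (r ^ d.-1) n, ~ Omega2 u0 ->
        forall u : nat -> U R (r ^ d.-1) n, als_run (tau w) u0 u ->
          is_minimizer (objective (tau w)) (u 1%N)].
Proof.
(* The targets for which some core has linearly dependent fibres. *)
exists [set w | W R r n w /\ core_dets w = 0]; split.
- by move=> w [].
- exact: null_W_core_dets.
move=> w [wW w0].
have /core_dets_neq0P wf : core_dets w != 0.
  by apply/eqP => w0'; apply: w0.
have n0 i : (0 < n i)%N by rewrite (leq_trans _ (hn i))// expn_gt0 hr.
pose q0 i : 'I_(n i) := Ordinal (n0 i).
(* The starting points for which the division-free loop meets a singular Gram matrix. *)
exists [set u | iterate_dets q0 w u = 0]; split.
  exact: null_U_iterate_dets.
move=> u0 /eqP D0 u [u0E step]; apply: (sweep_minimizer hd hr (u0 := u0) D0).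
by rewrite -u0E; exact: step.
Qed.
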